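(* Let $(R,\mathfrak m)$ be a commutative noetherian local ring with $\mathfrak m^3=0$ that is not Gorenstein, and let $e=\dim_{R/\mathfrak m}\mathfrak m/\mathfrak m^2$. If there is an exact zero divisor in $R$, then there exists a family $\{M_n\}_{n\in\mathbb N}$ of indecomposable totally reflexive $R$-modules with $\operatorname{length}_R M_n=ne$ for every $n\in\mathbb N$. Moreover, the minimal free resolution of each module $M_n$ is periodic of period at most $2$.
   Context: $\mathbb N=\{1,2,3,\dots\}$. For $x\in R$, $(0:x)$ denotes the annihilator of $x$. A non-invertible element $x\neq 0$ of $R$ is an exact zero divisor if there is an element $w\in R$ with $(0:x)=(w)$ and $(0:w)=(x)$. A finitely generated $R$-module $M$ is totally reflexive if there is an exact sequence $F\colon \cdots\to F_1\to F_0\to F_{-1}\to\cdots$ (infinite in both directions) of finitely generated free $R$-modules such that $M\cong\operatorname{Coker}(F_1\to F_0)$ and the dual sequence $\operatorname{Hom}_R(F,R)$ is also exact. *)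

(* Defs.v *)
From HB Require Import structures.
From mathcomp Require Import all_boot all_order all_algebra.
From mathcomp Require Import boolp classical_sets.

Set Implicit Arguments.
Unset Strict Implicit.
Unset Printing Implicit Defensive.

Import Order.TTheory GRing.Theory Num.Theory.

Local Open Scope classical_set_scope.
Local Open Scope ring_scope.

(* Submodules are Prop-valued subsets, so that no decidability assumption is
   hidden in a quantification over them.  Ideals of R are the submodules of
   the regular module R^o. *)
Definition submodule (R : comUnitRingType) (M : lmodType R) (N : set M) : Prop :=
  submod_closed [in N].

Definition ideal (R : comUnitRingType) (I : set R) : Prop :=
  @submodule R R^o I.

Definition span (R : comUnitRingType) (M : lmodType R) (n : nat)
    (g : 'I_n -> M) : set M :=
  [set x | exists c : 'I_n -> R, x = \sum_i c i *: g i].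

Definition fin_gen (R : comUnitRingType) (M : lmodType R) (N : set M) : Prop :=
  exists (n : nat) (g : 'I_n -> M), N = span g.

Definition noetherian (R : comUnitRingType) : Prop :=
  forall I : set R, ideal I -> @fin_gen R R^o I.

Definition maximal_ideal (R : comUnitRingType) (m : set R) : Prop :=
  [/\ ideal m, m <> setT &
      forall J : set R, ideal J -> m `<=` J -> J = m \/ J = setT].

Definition local_ring (R : comUnitRingType) (m : set R) : Prop :=
  maximal_ideal m /\ forall J : set R, maximal_ideal J -> J = m.

(* The submodule I N of M: finite sums of products a *: v, a in I, v in N. *)
Definition ideal_act (R : comUnitRingType) (M : lmodType R)
    (I : set R) (N : set M) : set M :=
  [set x | exists (n : nat) (a : 'I_n -> R) (v : 'I_n -> M),
     [/\ forall i, I (a i), forall i, N (v i) & x = \sum_i a i *: v i]].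

Fixpoint ideal_pow (R : comUnitRingType) (I : set R) (n : nat) : set R :=
  if n is k.+1 then @ideal_act R R^o I (ideal_pow I k) else setT.

(* dim_(R/m) m/m^2 = e: there are x_1, ..., x_e in m whose classes form a
   basis of m/m^2 over R/m. *)
Definition cotangent_dim (R : comUnitRingType) (m : set R) (e : nat) : Prop :=
  exists x : 'I_e -> R,
    [/\ forall i, m (x i),
        forall y, m y ->
          exists c : 'I_e -> R, ideal_pow m 2 (y - \sum_i c i * x i) &
        forall c : 'I_e -> R,
          ideal_pow m 2 (\sum_i c i * x i) -> forall i, m (c i)].

Definition annihilator (R : comUnitRingType) (x : R) : set R :=
  [set a | a * x = 0].

Definition principal (R : comUnitRingType) (x : R) : set R :=
  [set a | exists b, a = b * x].

Definition exact_zero_divisor (R : comUnitRingType) (x : R) : Prop :=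
  [/\ x \isn't a GRing.unit, x != 0 &
      exists w : R, annihilator x = principal w /\ annihilator w = principal x].

(* [exact_at f g]: the sequence A -> B -> C is exact at B. *)
Definition exact_at (R : comUnitRingType) (A B C : lmodType R)
    (f : {linear A -> B}) (g : {linear B -> C}) : Prop :=
  forall b : B, g b = 0 <-> exists a : A, b = f a.

Definition surjective (A B : Type) (f : A -> B) : Prop :=
  forall b, exists a, b = f a.

Definition zero_module (R : comUnitRingType) (M : lmodType R) : Prop :=
  forall x : M, x = 0.

Definition injective_module (R : comUnitRingType) (E : lmodType R) : Prop :=
  forall (A B : lmodType R) (f : {linear A -> B}) (g : {linear A -> E}),
    injective f -> exists h : {linear B -> E}, forall a, h (f a) = g a.

(* An injective resolution 0 -> M -> E_0 -> ... -> E_n -> 0. *)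
Definition finite_injdim (R : comUnitRingType) (M : lmodType R) : Prop :=
  exists (n : nat) (E : nat -> lmodType R) (eta : {linear M -> E 0%N})
         (d : forall i, {linear E i -> E i.+1}),
    [/\ forall i, injective_module (E i),
        injective eta,
        exact_at eta (d 0%N),
        forall i, exact_at (d i) (d i.+1) &
        forall i, (n < i)%N -> zero_module (E i)].

(* This is the definition for noetherian local rings. *)
Definition gorenstein_local (R : comUnitRingType) : Prop :=
  @finite_injdim R R^o.

Definition fin_free (R : comUnitRingType) (F : lmodType R) : Prop :=
  exists (n : nat) (f : {linear 'rV[R]_n -> F}), bijective f.

(* Exactness, at Hom(F_(i+1), R), of the dual of a complex
   F_(i+2) -> F_(i+1) -> F_i with differentials f and g. *)
Definition dual_exact_at (R : comUnitRingType) (A B C : lmodType R)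
    (f : {linear A -> B}) (g : {linear B -> C}) : Prop :=
  forall u : {linear B -> R^o},
    (forall a, u (f a) = 0) <->
    exists v : {linear C -> R^o}, forall b, u b = v (g b).

(* [d i] is the differential F_(i+1) -> F_i; the map [p] exhibits M as the
   cokernel of [d 0] : F_1 -> F_0. *)
Definition totally_reflexive (R : comUnitRingType) (M : lmodType R) : Prop :=
  fin_gen (setT : set M) /\
  exists (F : int -> lmodType R) (d : forall i : int, {linear F (i + 1) -> F i}),
    [/\ forall i, fin_free (F i),
        forall i, exact_at (d (i + 1)) (d i),
        forall i, dual_exact_at (d (i + 1)) (d i) &
        exists p : {linear F 0 -> M}, surjective p /\ exact_at (d 0) p].

Definition indecomposable (R : comUnitRingType) (M : lmodType R) : Prop :=
  ~ zero_module M /\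
  forall P Q : set M, submodule P -> submodule Q ->
    P `&` Q = [set 0] ->
    (forall x, exists p q, [/\ P p, Q q & x = p + q]) ->
    P = [set 0] \/ Q = [set 0].

(* M has a composition series 0 = N_0 < N_1 < ... < N_l = M. *)
Definition has_length (R : comUnitRingType) (M : lmodType R) (l : nat) : Prop :=
  exists N : nat -> set M,
    [/\ forall i, (i <= l)%N -> submodule (N i),
        N 0%N = [set 0],
        N l = setT &
        forall i, (i < l)%N ->
          N i `<` N i.+1 /\
          forall P : set M, submodule P -> N i `<=` P -> P `<=` N i.+1 ->
            P = N i \/ P = N i.+1].

(* A minimal free resolution ... -> F_1 -> F_0 -> M -> 0 over a local ring with
   maximal ideal m, where d i : F_(i+1) -> F_i has image in m F_i. *)
Definition minimal_free_resolution (R : comUnitRingType) (m : set R)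
    (M : lmodType R) (F : nat -> lmodType R)
    (d : forall i, {linear F i.+1 -> F i}) (p : {linear F 0%N -> M}) : Prop :=
  [/\ forall i, fin_free (F i),
      surjective p,
      exact_at (d 0%N) p,
      forall i, exact_at (d i.+1) (d i) &
      forall i x, ideal_act m (setT : set (F i)) (d i x)].

(* The complex is isomorphic to its own truncation F_(i >= q), shifted to start
   in degree 0.  A minimal free resolution is defined only up to isomorphism,
   so periodicity is stated up to isomorphism too. *)
Definition periodic (R : comUnitRingType) (F : nat -> lmodType R)
    (d : forall i, {linear F i.+1 -> F i}) (q : nat) : Prop :=
  exists f : forall i, {linear F (i + q)%N -> F i},
    (forall i, bijective (f i)) /\
    forall (i : nat) (x : F (i + q).+1), f i (d (i + q)%N x) = d i (f i.+1 x).

(* Main.v *)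
Require Import Defs.
From HB Require Import structures.
From mathcomp Require Import all_boot all_order all_algebra all_fingroup.
From mathcomp Require Import ring.
From mathcomp Require Import boolp classical_sets.

Set Implicit Arguments.
Unset Strict Implicit.
Unset Printing Implicit Defensive.

Import Order.TTheory GRing.Theory Num.Theory.
Local Open Scope classical_set_scope.
Local Open Scope ring_scope.

(** Let [(x, w)] be a pair of exact zero divisors: the annihilator of each one
is generated by the other.

Choice of elements.  If the maximal ideal [m] were generated by [x] and [w],
then [R] would be self-injective, hence Gorenstein
([exact_pair_gorenstein]): as [m] is nilpotent, Baer's criterion only has to be
checked on linear maps [m -> R] ([injective_module_regular]), and such a map is
determined by its values on [x] and [w].  So some [y] in [m] lies outside
[(x, w)].  It follows that neither [x] nor [w] is in [m^2], that
[m^2 = x m = w m], and that [m^2] has dimension [e - 1] over the residue field.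
Multiplication by [y] sends the [e]-dimensional space [m / m^2] into [m^2], so
it kills some [z] outside [m^2] ([max_annihilator]), and the choice of [y]
forces [z] to lie outside both [(x)] and [(w)].

The modules.  [M_n] is the cokernel of the bidiagonal matrix [A] of size [n]
with diagonal [w, x, w, x, ...] and subdiagonal [y, z, y, z, ...], acting on row
vectors.  Exchanging [x] and [w] and changing the sign of the subdiagonal gives
a matrix [B] with [A B = B A = 0], because [w x = 0] and [y z = 0].
Triangularity and the exactness of the pair [(x, w)] make the two-periodic
complex given by [A] and [B] exact, as well as its dual
([triangular_exact]).  Hence [M_n] is totally reflexive, its minimal resolution
is periodic of period at most two, and [M_n] is isomorphic to the kernel of
[A], which is the concrete module used below.

Length.  The filtration of [M_n] by the position of the last nonzero coordinate
has [n] quotients, isomorphic to [(x)] or [(w)]; each of them has length [e],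
since [m / (x)] and [m / (w)] have dimension [e - 1] ([ladder_length]).

Indecomposability.  A decomposition of [M_n] gives matrices [P] and [Q] with
[A P = Q A], where the rows of [P] represent the projections of the
generators.  Comparing coefficients modulo [m^2] shows that [P] is triangular
modulo [m] with constant diagonal ([ladder_rigid]).  So either [P] or [1 - P] is
invertible, and one of the two summands is the whole module. *)

(** * Submodules and ideals *)

Lemma submoduleP (R : comUnitRingType) (M : lmodType R) (N : set M) :
  submodule N <->
  N 0 /\ forall (a : R) (u v : M), N u -> N v -> N (a *: u + v).
Proof.
split=> [[N0 NL]|[N0 NL]].
- split=> [|a u v Nu Nv]; first by move: N0; rewrite inE.
  by have := NL a u v (mem_set Nu) (mem_set Nv); rewrite inE.
- split=> [|a u v]; first exact: mem_set.
  by rewrite !inE => Nu Nv; apply: NL.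
Qed.

Section Submodules.

Variables (R : comUnitRingType) (M : lmodType R) (N : set M).
Hypothesis subN : submodule N.

Lemma submodule0 : N 0.
Proof. by have /submoduleP[] := subN. Qed.

Lemma submoduleZ a u : N u -> N (a *: u).
Proof.
have /submoduleP[N0 NL] := subN => Nu.
by rewrite -[a *: u]addr0; apply: NL.
Qed.

Lemma submoduleD u v : N u -> N v -> N (u + v).
Proof.
have /submoduleP[N0 NL] := subN => Nu Nv.
by rewrite -[u]scale1r; apply: NL.
Qed.

Lemma submoduleN u : N u -> N (- u).
Proof. by move=> Nu; rewrite -scaleN1r; apply: submoduleZ. Qed.

Lemma submoduleB u v : N u -> N v -> N (u - v).
Proof. by move=> Nu Nv; apply: submoduleD => //; apply: submoduleN. Qed.

Lemma submodule_sum (I : Type) (r : seq I) (P : pred I) (F : I -> M) :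
  (forall i, P i -> N (F i)) -> N (\sum_(i <- r | P i) F i).
Proof.
move=> NF; apply: big_ind => //; [exact: submodule0|exact: submoduleD].
Qed.

End Submodules.

Lemma ideal_act1 (R : comUnitRingType) (M : lmodType R) (I : set R)
    (N : set M) a v :
  I a -> N v -> ideal_act I N (a *: v).
Proof.
move=> Ia Nv; exists 1%N, (fun=> a), (fun=> v); split=> //.
by rewrite big_ord1.
Qed.

Lemma submodule_ideal_act (R : comUnitRingType) (M : lmodType R) (I : set R)
    (N : set M) :
  ideal I -> submodule (ideal_act I N).
Proof.
move=> idI; apply/submoduleP; split=> [|c x y].
  by exists 0%N, (fun=> 0), (fun=> 0); split; [case|case|rewrite big_ord0].
move=> [n [a [v [Ia Nv ->]]]] [k [b [w [Ib Nw ->]]]].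
exists (n + k)%N.
exists (fun i => match split i with inl i => c * a i | inr i => b i end).
exists (fun i => match split i with inl i => v i | inr i => w i end).
split=> [i|i|].
- by case: (split i) => // j; apply: (@submoduleZ _ R^o _ idI).
- by case: (split i).
rewrite big_split_ord scaler_sumr; congr (_ + _); apply: eq_bigr => i _.
  by rewrite (unsplitK (inl i)) scalerA.
by rewrite (unsplitK (inr i)).
Qed.

(** * Local rings whose maximal ideal has cube zero *)

(** In the names below, [max] stands for the maximal ideal [m] and [msqr] for
its square. *)
Section LocalRing.

Variables (R : comUnitRingType) (m : set R).
Hypotheses (R_local : local_ring m) (m3_eq0 : ideal_pow m 3 = [set 0]).

Lemma max_ideal : ideal m.
Proof. by have [[]] := R_local. Qed.

Lemma max0 : m 0. Proof. exact: (@submodule0 _ R^o _ max_ideal). Qed.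
Lemma maxD a b : m a -> m b -> m (a + b).
Proof. exact: (@submoduleD _ R^o _ max_ideal). Qed.
Lemma maxN a : m a -> m (- a).
Proof. exact: (@submoduleN _ R^o _ max_ideal). Qed.
Lemma maxB a b : m a -> m b -> m (a - b).
Proof. exact: (@submoduleB _ R^o _ max_ideal). Qed.
Lemma maxMl a b : m b -> m (a * b).
Proof. exact: (@submoduleZ _ R^o _ max_ideal). Qed.
Lemma maxMr a b : m a -> m (a * b).
Proof. by rewrite mulrC; apply: maxMl. Qed.

Lemma msqr_ideal : ideal (ideal_pow m 2).
Proof. exact: (@submodule_ideal_act _ R^o _ _ max_ideal). Qed.

Lemma msqr0 : ideal_pow m 2 0. Proof. exact: (@submodule0 _ R^o _ msqr_ideal). Qed.
Lemma msqrD a b : ideal_pow m 2 a -> ideal_pow m 2 b -> ideal_pow m 2 (a + b).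
Proof. exact: (@submoduleD _ R^o _ msqr_ideal). Qed.
Lemma msqrB a b : ideal_pow m 2 a -> ideal_pow m 2 b -> ideal_pow m 2 (a - b).
Proof. exact: (@submoduleB _ R^o _ msqr_ideal). Qed.
Lemma msqrMl a b : ideal_pow m 2 b -> ideal_pow m 2 (a * b).
Proof. exact: (@submoduleZ _ R^o _ msqr_ideal). Qed.

Lemma msqrM a b : m a -> m b -> ideal_pow m 2 (a * b).
Proof.
move=> ma mb; apply: (@ideal_act1 _ R^o) => //.
by rewrite -[b]mulr1; apply: (@ideal_act1 _ R^o).
Qed.

Lemma mul_max_msqr a p : m a -> ideal_pow m 2 p -> a * p = 0.
Proof.
move=> ma m2p; have : ideal_pow m 3 (a * p) by apply: (@ideal_act1 _ R^o).
by rewrite m3_eq0.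
Qed.

Lemma max_cube a : m a -> a ^+ 3 = 0.
Proof. by move=> ma; rewrite exprS; apply: mul_max_msqr => //; apply: msqrM. Qed.

(** The inverse is the geometric series, which stops because [a ^+ 3 = 0]. *)
Lemma max_unit1B a : m a -> 1 - a \is a GRing.unit.
Proof.
move=> ma; apply/unitrPr; exists (1 + a + a ^+ 2).
have -> : (1 - a) * (1 + a + a ^+ 2) = 1 - a ^+ 3 by ring.
by rewrite max_cube // subr0.
Qed.

Lemma max_not1 : ~ m 1.
Proof. by move=> /max_unit1B; rewrite subrr unitr0. Qed.

Lemma max_nonunit a : m a -> a \isn't a GRing.unit.
Proof.
move=> ma; apply/negP => ua; apply: max_not1.
by rewrite -(mulVr ua); apply: maxMl.
Qed.

(** Outside [m], an element [a] satisfies [m + (a) = R] by maximality, so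
[1 - c * a] is in [m] for some [c], and [c * a] is a unit. *)
Lemma notin_max_unit a : ~ m a -> a \is a GRing.unit.
Proof.
move=> nma; have [[_ _ maxm] _] := R_local.
pose J := [set t : R | exists b c, m b /\ t = b + c * a].
have idJ : ideal J.
  apply/submoduleP; split.
    by exists 0, 0; split; [exact: max0|ring].
  move=> k u v [b [c [mb ->]]] [b' [c' [mb' ->]]].
  exists (k * b + b'), (k * c + c'); split.
    by apply: maxD => //; apply: maxMl.
  by rewrite /GRing.scale /=; ring.
have [||JT] := maxm J idJ.
- by move=> t mt; exists t, 0; split=> //; ring.
- by move=> Jm; case: nma; rewrite -Jm; exists 0, 1; split; [exact: max0|ring].
have [b [c [mb]]] : J 1 by rewrite JT.
move=> e1; have : c * a \is a GRing.unit.
  have -> : c * a = 1 - b by rewrite e1; ring.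
  exact: max_unit1B.
by rewrite unitrM => /andP[].
Qed.

Lemma nonunit_max a : a \isn't a GRing.unit -> m a.
Proof. by move=> ua; apply: contrapT => /notin_max_unit; apply/negP. Qed.

End LocalRing.

(** * Self-injective rings *)

Lemma linear_ex (R : comUnitRingType) (U V : lmodType R) (f : U -> V) :
  linear f -> exists h : {linear U -> V}, h =1 f.
Proof.
move=> lf; pose F := GRing.isLinear.Build R U V *:%R f lf.
pose h : {linear U -> V} := HB.pack f F.
by exists h.
Qed.

Section SelfInjective.

Variables (R : comUnitRingType) (m : set R).
Hypotheses (R_local : local_ring m) (m3_eq0 : ideal_pow m 3 = [set 0]).

(** Baer's condition for the ideal [m] alone: every linear map from [m] to [R]
is multiplication by an element.  Only the values of [phi] on [m] matter. *)
Definition max_extension : Prop := forall phi : R -> R,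
  (forall c u v, m u -> m v -> phi (c * u + v) = c * phi u + phi v) ->
  exists a, forall v, m v -> phi v = a * v.

Section Extension.

Variables (A B : lmodType R) (f : {linear A -> B}) (g : {linear A -> R^o}).

(** Extensions of [g] along [f] to a submodule of [B], given by their graphs. *)
Definition partial_extension (G : set (B * R^o)) : Prop :=
  [/\ submodule G, forall r, G (0, r) -> r = 0 & forall a, G (f a, g a)].

Hypothesis max_ext : max_extension.

Lemma partial_extension_fun G b r s :
  partial_extension G -> G (b, r) -> G (b, s) -> r = s.
Proof.
move=> [subG funG _] Gr Gs; apply/eqP; rewrite -subr_eq0; apply/eqP/funG.
have := submoduleB subG Gr Gs.
by rewrite (_ : (b, r) - (b, s) = (0, r - s)) // -[0](subrr b).
Qed.

(** The domain of a maximal partial extension is all of [B].  As [m] is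
nilpotent, a proper domain would miss some [b] with [m b] inside it; Baer's
condition for [m] then extends the map to [b]. *)
Lemma partial_extension_total G : partial_extension G ->
  (forall G', G `<` G' -> ~ partial_extension G') ->
  forall b, exists r, G (b, r).
Proof.
move=> pG maxG; have [subG funG extG] := pG.
pose D (b : B) := exists r, G (b, r).
(* Applied three times, [H] reduces the claim for [b] to [m^3 b = 0]. *)
suff H : forall b, (forall t, m t -> D (t *: b)) -> D b.
  move=> b; apply: (H b) => t mt; apply: (H _) => u mu; apply: (H _) => v mv.
  rewrite scalerA.
  exists 0; rewrite scalerA -mulrA (mul_max_msqr m3_eq0 mv (msqrM mu mt)) scale0r.
  exact: (submodule0 subG).
move=> b Db; apply: contrapT => nDb.
have [phi phiP] : exists phi : R -> R, forall t, m t -> G (t *: b, phi t).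
  have /choice[phi phiP] : forall t, exists r : R, m t -> G (t *: b, r).
    move=> t; have [/Db[r Gr]|nmt] := pselect (m t); first by exists r.
    by exists 0 => /nmt.
  by exists phi.
have [a phiE] : exists a, forall v, m v -> phi v = a * v.
  apply: max_ext => c u v mu mv.
  apply: (@partial_extension_fun G ((c * u + v) *: b)) => //.
    by apply: phiP; apply: (maxD R_local) => //; apply: (maxMl R_local).
  rewrite scalerDl -scalerA.
  have /submoduleP[_ GL] := subG.
  exact: (GL c _ _ (phiP u mu) (phiP v mv)).
pose G' : set (B * R^o) :=
  [set z | exists u r c, G (u, r) /\ z = (u + c *: b, r + c * a)].
apply: (maxG G'); [split|split].
- move=> [u r] Gur; exists u, r, 0; split=> //.
  by rewrite scale0r mul0r !addr0.
- move=> G'G; apply: nDb; exists a; apply: G'G; exists 0, 0, 1; split.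
    exact: (submodule0 subG).
  by rewrite scale1r mul1r !add0r.
- apply/submoduleP; split.
    exists 0, 0, 0; split; first exact: (submodule0 subG).
    by rewrite scale0r mul0r !addr0.
  move=> k _ _ [u [r [c [Gu ->]]]] [u' [r' [c' [Gu' ->]]]].
  exists (k *: u + u'), (k * r + r'), (k * c + c'); split.
    by have /submoduleP[_ GL] := subG; exact: (GL k _ _ Gu Gu').
  congr (_, _) => /=; rewrite ?scalerDl ?scalerDr ?scalerA; first exact: addrACA.
  by rewrite /GRing.scale /=; ring.
- move=> r [u [s [c [Gus [e1 e2]]]]].
  have eu : u = - (c *: b) by apply/eqP; rewrite -addr_eq0 -e1.
  have mc : m c.
    apply: contrapT => /(notin_max_unit R_local m3_eq0) uc; apply: nDb.
    exists (- (c^-1 * s)); have := submoduleZ subG (- c^-1) Gus.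
    rewrite -[_ *: (u, s)]/(- c^-1 *: u, - c^-1 * s) eu scalerN scaleNr opprK.
    by rewrite scalerA mulVr // scale1r mulNr.
  have := submoduleD subG Gus (phiP c mc).
  rewrite (_ : (u, s) + _ = (0, s + phi c)); last first.
    by rewrite eu -[0](addNr (c *: b)).
  by move=> /funG; rewrite e2 phiE // [a * c]mulrC.
- move=> a0; exists (f a0), (g a0), 0; split=> //.
  by rewrite scale0r mul0r !addr0.
Qed.

End Extension.

(** Zorn's lemma yields a maximal partial extension. *)
Lemma injective_module_regular : max_extension -> @injective_module R R^o.
Proof.
move=> max_ext A B f g f_inj.
(* The empty set is included because an empty chain has an empty union. *)
pose P (G : set (B * R^o)) := G = set0 \/ partial_extension f g G.
have base : partial_extension f g [set z | exists a, z = (f a, g a)].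
  split.
  - apply/submoduleP; split; first by exists 0; rewrite !linear0.
    by move=> c _ _ [a ->] [b ->]; exists (c *: a + b); rewrite !linearP.
  - move=> r [a [fa ->]]; have -> : a = 0 by apply: f_inj; rewrite linear0.
    by rewrite linear0.
  - by move=> a; exists a.
have [F FP totF|G [PG maxG]] := @Zorn_bigcup _ P.
  have [[G0 [FG0 pG0]]|noG] :=
    pselect (exists G, F G /\ partial_extension f g G); last first.
    left; apply/seteqP; split=> // z [G FG Gz]; case: (FP _ FG) => pG.
      by move: Gz; rewrite pG.
    by case: noG; exists G.
  have pF G z : F G -> G z -> partial_extension f g G.
    by move=> FG Gz; case: (FP _ FG) => // G_0; move: Gz; rewrite G_0.
  right; split.
  - apply/submoduleP; split.
      by exists G0 => //; case: pG0 => sG0 _ _; exact: (submodule0 sG0).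
    move=> c u v [X FX Xu] [Y FY Yv].
    have [XY|YX] := totF _ _ FX FY.
      exists Y => //; have [/submoduleP[_ YL] _ _] := pF _ _ FY Yv.
      by apply: YL => //; apply: XY.
    exists X => //; have [/submoduleP[_ XL] _ _] := pF _ _ FX Xu.
    by apply: XL => //; apply: YX.
  - by move=> r [X FX Xr]; have [_ XF _] := pF _ _ FX Xr; apply: XF.
  - by move=> a; exists G0 => //; case: pG0.
case: PG => [G_0|pG].
  case: (maxG [set z | exists a, z = (f a, g a)]); last by right.
  split; first by rewrite G_0.
  by move=> /(_ (f 0, g 0)); rewrite G_0 => H; apply: H; exists 0.
have tot := partial_extension_total max_ext pG
  (fun G' GG' pG' => maxG _ GG' (or_intror pG')).
have [h hP] := choice tot.
have [subG _ extG] := pG.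
have [c u v|h' h'E] := @linear_ex R B R^o h.
  apply: (partial_extension_fun pG (hP _)).
  by have /submoduleP[_ GL] := subG; exact: (GL c _ _ (hP u) (hP v)).
exists h' => a; rewrite h'E.
exact: (partial_extension_fun pG (hP _) (extG a)).
Qed.

(** A self-injective ring is its own injective resolution. *)
Lemma self_injective_gorenstein :
  @injective_module R R^o -> gorenstein_local R.
Proof.
move=> injR.
pose E (i : nat) : lmodType R := if i is 0%N then R^o else 'rV[R]_0.
have [eta etaE] : exists h : {linear R^o -> E 0%N}, h =1 id.
  by apply: linear_ex.
have zE i : (0 < i)%N -> zero_module (E i).
  by case: i => // i _ x; exact: (thinmx0 (x : 'rV[R]_0)).
have d0 i : {linear E i -> E i.+1}.
  exact: (\0 : {linear E i -> E i.+1}).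
exists 0%N, E, eta, d0; split.
- case=> [|i] //= A B f g _; exists (\0 : {linear B -> E i.+1}) => a.
  by rewrite [g a](zE i.+1).
- by move=> x y; rewrite !etaE.
- move=> b; split=> _; first by exists b; rewrite etaE.
  exact: (zE 1%N).
- by move=> i b; split=> _; [exists 0; rewrite linear0|]; apply: zE.
- exact: zE.
Qed.

End SelfInjective.

(** * Linear algebra modulo the maximal ideal *)

Section LocalLinearAlgebra.

Variables (R : comUnitRingType) (m : set R).
Hypotheses (R_local : local_ring m) (m3_eq0 : ideal_pow m 3 = [set 0]).

Lemma max_sum (I : Type) (r : seq I) (P : pred I) (F : I -> R) :
  (forall i, P i -> m (F i)) -> m (\sum_(i <- r | P i) F i).
Proof. exact: (@submodule_sum _ R^o _ (max_ideal R_local)). Qed.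

Lemma msqr_sum (I : Type) (r : seq I) (P : pred I) (F : I -> R) :
  (forall i, P i -> ideal_pow m 2 (F i)) ->
  ideal_pow m 2 (\sum_(i <- r | P i) F i).
Proof. exact: (@submodule_sum _ R^o _ (msqr_ideal R_local)). Qed.

Lemma max_prime a b : m (a * b) -> ~ m a -> m b.
Proof.
move=> mab /(notin_max_unit R_local m3_eq0) ua.
by rewrite -(mulKr ua b); apply: (maxMl R_local).
Qed.

(** Over the residue field, a matrix with one row more than columns has a
nonzero left kernel.  The proof is Gaussian elimination on the first column. *)
Lemma kernel_mod_max p (A : 'I_p.+1 -> 'I_p -> R) :
  exists c : 'I_p.+1 -> R,
    ~ (forall i, m (c i)) /\ forall j, m (\sum_i c i * A i j).
Proof.
elim: p A => [|p IHp] A.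
  by exists (fun=> 1); split=> [/(_ ord0)|[]//]; apply: (max_not1 m3_eq0).
(* [c] is a row vector for the rows other than [i0], to be completed by [c0]. *)
have ext i0 (c : 'I_p.+1 -> R) c0 : ~ (forall i, m (c i)) ->
    (forall j, m (c0 * A i0 j + \sum_i c i * A (lift i0 i) j)) ->
    exists c : 'I_p.+2 -> R,
      ~ (forall i, m (c i)) /\ forall j, m (\sum_i c i * A i j).
  move=> nc cA; exists (fun i => if unlift i0 i is Some k then c k else c0).
  split=> [mc|j]; first by apply: nc => i; have := mc (lift i0 i); rewrite liftK.
  rewrite (bigD1_ord i0) //= unlift_none.
  by under eq_bigr => i _ do rewrite liftK.
have [/existsP[i0 /asboolP nm0]|/existsPn m0] :=
    boolP [exists i0, `[< ~ m (A i0 ord0) >]].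
  have u0 := notin_max_unit R_local m3_eq0 nm0.
  pose r i := A (lift i0 i) ord0 / A i0 ord0.
  have [c [nc cA]] := IHp (fun i j =>
    A (lift i0 i) (lift ord0 j) - r i * A i0 (lift ord0 j)).
  apply: (ext i0 c (- \sum_i c i * r i)) => // j.
  have -> : - (\sum_i c i * r i) * A i0 j + \sum_i c i * A (lift i0 i) j =
            \sum_i c i * (A (lift i0 i) j - r i * A i0 j).
    rewrite mulNr mulr_suml -sumrN -big_split /=; apply: eq_bigr => i _.
    by ring.
  have [->|[j' ->]] : j = ord0 \/ exists j', j = lift ord0 j'.
    by case: (unliftP ord0 j) => [j' ->|->]; [right; exists j'|left].
  - rewrite big1 => [|i _]; first exact: (max0 R_local).
    by rewrite /r divrK // subrr mulr0.
  - exact: cA.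
have [c [nc cA]] := IHp (fun i j => A (lift ord0 i) (lift ord0 j)).
apply: (ext ord0 c 0) => // j; rewrite mul0r add0r.
case: (unliftP ord0 j) => [j' ->|->]; first exact: cA.
apply: max_sum => i _; apply: (maxMl R_local); apply: contrapT => nm.
by have := m0 (lift ord0 i); rewrite asboolT.
Qed.

End LocalLinearAlgebra.

(** * Pairs of exact zero divisors *)

(** The elements [b] of [m] form a basis of [m / (d)] over the residue field,
when [m ^ 2] is contained in [(d)] and [d] is in [m]. *)
Definition basis_mod (R : comUnitRingType) (m : set R) (e : nat)
    (b : 'I_e -> R) (d : R) : Prop :=
  [/\ forall i, m (b i),
      forall v, m v -> exists c a, v = \sum_i c i * b i + a * d &
      forall c a, \sum_i c i * b i = a * d -> forall i, m (c i)].

Section ExactPair.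

Variables (R : comUnitRingType) (m : set R).
Hypotheses (R_local : local_ring m) (m3_eq0 : ideal_pow m 3 = [set 0]).

(** The annihilators of [x] and of [w] are [(w)] and [(x)] respectively, and
both elements are in [m]; [w != 0] follows, so the notion is symmetric. *)
Record exact_pair (x w : R) : Prop := ExactPair {
  pair_max1 : m x;
  pair_max2 : m w;
  pair_neq0 : x != 0;
  pair_mul0 : w * x = 0;
  pair_ann1 : forall a, a * x = 0 -> exists b, a = b * w;
  pair_ann2 : forall a, a * w = 0 -> exists b, a = b * x }.

Lemma exact_zero_divisor_pair x :
  exact_zero_divisor x -> exists w, exact_pair x w.
Proof.
move=> [nux x0 [w [annx annw]]]; exists w.
have wx : w * x = 0.
  have : annihilator x w by rewrite annx; exists 1; rewrite mul1r.
  by [].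
split=> //.
- exact: (nonunit_max R_local m3_eq0).
- apply: (nonunit_max R_local m3_eq0); apply/negP => uw.
  by move/eqP: x0; apply; rewrite -(mulKr uw x) wx mulr0.
- by move=> a ax; have : annihilator x a by []; rewrite annx.
- by move=> a aw; have : annihilator w a by []; rewrite annw.
Qed.

Lemma exact_pair_sym x w : exact_pair x w -> exact_pair w x.
Proof.
move=> [mx mw x0 wx ax aw]; split=> //; last by rewrite mulrC.
apply/negP => /eqP w0; have [|b e1] := aw 1; first by rewrite w0 mulr0.
by apply: (max_not1 m3_eq0); rewrite e1; apply: (maxMl R_local).
Qed.

Variables (x w : R).
Hypothesis xw : exact_pair x w.

(** If [m = (x, w)], then [R] is self-injective.  Given a linear map [phi] on
[m], the annihilators of [x] and [w] give [phi w = a * w] and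
[phi x = (a + b) * x].  Evaluating [phi] at a nonzero socle element, a multiple
of both [x] and [w], shows that [b] is in [m]; then [b * x] is a multiple of
[x ^+ 2], and correcting [a] by a multiple of [x] does not affect [w]. *)
Lemma exact_pair_gorenstein :
  (forall v, m v -> exists a b, v = a * w + b * x) -> gorenstein_local R.
Proof.
move=> mxw; apply: self_injective_gorenstein.
apply: (injective_module_regular R_local m3_eq0) => phi phiL.
have [mx mw x0 wx annx annw] := xw.
have m0 := max0 R_local.
have phi0 : phi 0 = 0.
  by have := phiL (-1) 0 0 m0 m0; rewrite mulr0 addr0 mulN1r addNr.
have phiM c u : m u -> phi (c * u) = c * phi u.
  by move=> mu; have := phiL c u 0 mu m0; rewrite !addr0 phi0 addr0.
have [a phiw] : exists a, phi w = a * w.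
  by apply: annx; rewrite mulrC -phiM // mulrC wx.
have [b phix] : exists b, phi x - a * x = b * x.
  by apply: annw; rewrite mulrC mulrBr -phiM // wx phi0 mulrCA wx mulr0 subr0.
(* [s] is a nonzero element of the socle. *)
have [s [s0 ws xs]] : exists s, [/\ s != 0, s * w = 0 & s * x = 0].
  have [xx|xx] := eqVneq (x * x) 0.
    by exists x; split=> //; rewrite mulrC.
  exists (x * x); split=> //; first by rewrite mulrC mulrA wx mul0r.
  by rewrite -[x * x]expr2 -exprSr (max_cube m3_eq0 mx).
have [al sw] := annx _ xs; have [be sx] := annw _ ws.
have mb : m b.
  apply: contrapT => /(notin_max_unit R_local m3_eq0) ub.
  have bs : b * s = 0.
    have := phiM be x mx; rewrite -sx sw phiM // phiw.
    have -> : phi x = a * x + b * x by rewrite -phix; ring.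
    rewrite -mulrDl mulrCA -sw mulrCA -sx mulrDl => /eqP.
    by rewrite -subr_eq0 opprD addrA subrr sub0r oppr_eq0 => /eqP.
  by move/eqP: s0; apply; rewrite -(mulKr ub s) bs mulr0.
have [b1 [b2 eb]] := mxw b mb.
exists (a + b2 * x) => v /mxw[al' [be' ->]].
rewrite phiL //; last exact: (maxMl R_local).
rewrite phiM // phiw.
have -> : phi x = a * x + b * x by rewrite -phix; ring.
rewrite eb; have -> : al' * (a * w) + be' * (a * x + (b1 * w + b2 * x) * x) =
  (a + b2 * x) * (al' * w + be' * x) + (be' * b1 - b2 * al') * (w * x) by ring.
by rewrite wx mulr0 addr0.
Qed.

Lemma exact_pair_not_msqr y : m y -> (forall a b, y <> a * w + b * x) ->
  ~ ideal_pow m 2 x.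
Proof.
move=> my yxw m2x.
have [b yb] := pair_ann1 xw (mul_max_msqr m3_eq0 my m2x).
by apply: (yxw b 0); rewrite mul0r addr0.
Qed.

Hypothesis x_not_msqr : ~ ideal_pow m 2 x.

Lemma msqr_coef a : ideal_pow m 2 (a * x) -> m a.
Proof.
move=> m2; apply: contrapT => /(notin_max_unit R_local m3_eq0) ua.
by apply: x_not_msqr; rewrite -(mulKr ua x); apply: (msqrMl R_local).
Qed.

(** [m^2] is contained in [x m]: it is killed by [w]. *)
Lemma msqr_multiple p : ideal_pow m 2 p -> exists b, m b /\ p = b * x.
Proof.
move=> m2p; have := mul_max_msqr m3_eq0 (pair_max2 xw) m2p.
rewrite mulrC => /(pair_ann2 xw)[b e1]; exists b; split=> //.
by apply: msqr_coef; rewrite -e1.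
Qed.

(** Exchange: [x] replaces one element of a basis of [m / m^2], and the other
elements form a basis of [m / (x)]. *)
Lemma cotangent_basis_mod e : cotangent_dim m e ->
  exists (e' : nat) (b : 'I_e' -> R), e = e'.+1 /\ basis_mod m b x.
Proof.
move=> [t [mt t_gen t_free]].
have [g gx] := t_gen x (pair_max1 xw).
have [i0 ng0] : exists i0, ~ m (g i0).
  apply: contrapT => /forallNP ng; apply: x_not_msqr.
  rewrite -(subrK (\sum_i g i * t i) x); apply: (msqrD R_local) => //.
  apply: (msqr_sum R_local) => i _; apply: msqrM => //.
  exact: contrapT.
have ug := notin_max_unit R_local m3_eq0 ng0.
case: e t mt t_gen t_free g gx i0 ng0 ug => [|e] t mt t_gen t_free g gx i0.
  by case: i0.
move=> ng0 ug; exists e, (fun i => t (lift i0 i)); split=> //.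
split=> // [v mv|c a ca].
- have [c vc] := t_gen v mv.
  pose r := c i0 / g i0.
  have m2 : ideal_pow m 2
      (v - (\sum_i (c (lift i0 i) - r * g (lift i0 i)) * t (lift i0 i) + r * x)).
    have := msqrB R_local vc (msqrMl R_local r gx).
    rewrite !(bigD1_ord i0) //=.
    suff -> : \sum_i (c (lift i0 i) - r * g (lift i0 i)) * t (lift i0 i) =
      \sum_i c (lift i0 i) * t (lift i0 i) -
      r * \sum_i g (lift i0 i) * t (lift i0 i).
      have {1}-> : c i0 = r * g i0 by rewrite divrK.
      by congr (ideal_pow m 2 _); ring.
    rewrite mulr_sumr -sumrB; apply: eq_bigr => i _; ring.
  have [b [_ e1]] := msqr_multiple m2.
  exists (fun i => c (lift i0 i) - r * g (lift i0 i)), (r + b).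
  by rewrite mulrDl addrA -e1; ring.
pose c' i := if unlift i0 i is Some k then c k else 0.
have m2 : ideal_pow m 2 (\sum_i (c' i - a * g i) * t i).
  have := msqrMl R_local a gx; congr (ideal_pow m 2 _).
  under [RHS]eq_bigr => i _ do rewrite mulrBl -mulrA.
  rewrite sumrB -mulr_sumr mulrBr; congr (_ - _).
  rewrite (bigD1_ord i0) //= /c' unlift_none mul0r add0r -ca.
  by apply: eq_bigr => i _; rewrite liftK.
have ma : m a.
  have := t_free _ m2 i0; rewrite /c' unlift_none sub0r => /(maxN R_local).
  by rewrite opprK mulrC => /(max_prime R_local m3_eq0); apply.
move=> i; have := t_free _ m2 (lift i0 i); rewrite /c' liftK => mi.
by rewrite -(subrK (a * g (lift i0 i)) (c i)); apply: (maxD R_local) => //;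
  apply: (maxMr R_local).
Qed.

(** As [m^2 = w m] is isomorphic to [m / (x)], the products of [y] with a basis
of [m / m^2] are given by a matrix with one row more than columns. *)
Lemma max_annihilator e y : cotangent_dim m e -> m y -> ~ ideal_pow m 2 w ->
  exists z, [/\ m z, ~ ideal_pow m 2 z & y * z = 0].
Proof.
move=> dime my nw.
have [e' [b [ee [mb b_gen _]]]] := cotangent_basis_mod dime.
have [t [mt t_gen t_free]] := dime.
have yt i : exists c : 'I_e' -> R, y * t i = w * \sum_r c r * b r.
  have /(mul_max_msqr m3_eq0 (pair_max1 xw)) := msqrM my (mt i).
  rewrite mulrC => /(pair_ann1 xw)[v yv].
  have mv : m v.
    apply: contrapT => /(notin_max_unit R_local m3_eq0) uv; apply: nw.
    rewrite -(mulKr uv w) -yv; apply: (msqrMl R_local).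
    exact: msqrM.
  have [c [a vc]] := b_gen v mv; exists c.
  by rewrite yv vc mulrC mulrDr mulrCA (pair_mul0 xw) mulr0 addr0.
have [A AP] := choice yt.
subst e.
have [c [nc cA]] := kernel_mod_max R_local m3_eq0 A.
exists (\sum_i c i * t i); split.
- by apply: (max_sum R_local) => i _; apply: (maxMl R_local).
- by move/t_free.
have -> : y * \sum_i c i * t i = w * \sum_r (\sum_i c i * A i r) * b r.
  rewrite mulr_sumr.
  under eq_bigr => i _ do rewrite mulrCA AP mulrCA mulr_sumr.
  rewrite -mulr_sumr exchange_big /=; congr (w * _); apply: eq_bigr => r _.
  by rewrite mulr_suml; apply: eq_bigr => i _; rewrite mulrA.
apply: (mul_max_msqr m3_eq0 (pair_max2 xw)); apply: (msqr_sum R_local) => r _.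
exact: msqrM.
Qed.

Lemma annihilator_not_multiple y z a b :
  (forall a b, y <> a * w + b * x) -> ~ ideal_pow m 2 z -> m z ->
  y * z = 0 -> a * z = b * x -> m a.
Proof.
move=> yxw nz mz yz az; apply: contrapT => na.
have ua := notin_max_unit R_local m3_eq0 na.
have zE : z = a^-1 * b * x by rewrite -mulrA -az mulKr.
have nb : ~ m (a^-1 * b).
  by move=> mb; apply: nz; rewrite zE; apply: msqrM => //; exact: pair_max1 xw.
have ub := notin_max_unit R_local m3_eq0 nb.
have /(pair_ann1 xw)[c yc] : y * x = 0.
  have yx : (a^-1 * b) * (y * x) = 0 by rewrite mulrCA -zE.
  by rewrite -(mulKr ub (y * x)) yx mulr0.
by apply: (yxw c 0); rewrite mul0r addr0.
Qed.

End ExactPair.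

(** The properties of [x], [w], [y] and [z] on which the construction rests.
The last three say that [y] is outside [(x, w)] and [z] outside [(x)] and [(w)],
in the form used for comparing coefficients. *)
Record ladder_data (R : comUnitRingType) (m : set R) (x w y z : R) : Prop :=
  LadderData {
    ladder_pair : exact_pair m x w;
    ladder_max1 : m y;
    ladder_max2 : m z;
    ladder_mul0 : y * z = 0;
    ladder_msqr1 : forall a, ideal_pow m 2 (a * x) -> m a;
    ladder_msqr2 : forall a, ideal_pow m 2 (a * w) -> m a;
    ladder_mult1 : forall p, ideal_pow m 2 p -> exists b, p = b * x;
    ladder_mult2 : forall p, ideal_pow m 2 p -> exists b, p = b * w;
    ladder_indep : forall a b c, a * y = b * w + c * x -> m a;
    ladder_indep1 : forall a b, a * z = b * x -> m a;
    ladder_indep2 : forall a b, a * z = b * w -> m a }.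

Lemma ladder_data_exists (R : comUnitRingType) (m : set R) (e : nat) (x w : R) :
  local_ring m -> ideal_pow m 3 = [set 0] -> ~ gorenstein_local R ->
  cotangent_dim m e -> exact_pair m x w ->
  [/\ exists y z, ladder_data m x w y z,
      ~ ideal_pow m 2 x & ~ ideal_pow m 2 w].
Proof.
move=> Rl m3 nG dime xw; have wx := exact_pair_sym Rl m3 xw.
have [y [my yxw]] : exists y, m y /\ forall a b, y <> a * w + b * x.
  apply: contrapT => H; apply: nG; apply: (exact_pair_gorenstein Rl m3 xw) => v mv.
  apply: contrapT => nv; apply: H; exists v; split=> // a b vE.
  by apply: nv; exists a, b.
have ywx a b : y <> a * x + b * w by rewrite addrC.
have nx := exact_pair_not_msqr m3 xw my yxw.
have nw := exact_pair_not_msqr m3 wx my ywx.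
split=> //.
have [z [mz nz yz]] := max_annihilator Rl m3 xw nx dime my nw.
exists y, z; split=> //.
- exact: (msqr_coef Rl m3 nx).
- exact: (msqr_coef Rl m3 nw).
- by move=> p /(msqr_multiple Rl m3 xw nx)[b [_ ->]]; exists b.
- by move=> p /(msqr_multiple Rl m3 wx nw)[b [_ ->]]; exists b.
- move=> a b c ay; apply: contrapT => /(notin_max_unit Rl m3) ua.
  apply: (yxw (a^-1 * b) (a^-1 * c)).
  by rewrite -!mulrA -mulrDr -ay mulKr.
- by move=> a b; apply: (annihilator_not_multiple Rl m3 xw yxw nz mz yz).
- by move=> a b; apply: (annihilator_not_multiple Rl m3 wx ywx nz mz yz).
Qed.

(** * Rigidity of the bidiagonal equations *)

(** Reduces an equation to a linear combination that [ring] can check. *)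
Lemma eq_from (V : zmodType) (a b c d : V) : a = b -> c - d = a - b -> c = d.
Proof. by move=> -> /eqP; rewrite subrr subr_eq0 => /eqP. Qed.

Section Rigidity.

Variables (R : comUnitRingType) (m : set R) (x w y z : R).
Hypotheses (R_local : local_ring m) (m3_eq0 : ideal_pow m 3 = [set 0]).
Hypothesis L : ladder_data m x w y z.

(** The alternating sequences [w, x, w, x, ...] and [y, z, y, z, ...]. *)
Definition ladder_diag (k : nat) : R := if odd k then x else w.
Definition ladder_side (k : nat) : R := if odd k then z else y.

Let mD := maxD R_local.
Let mB := maxB R_local.

Lemma max_transfer a b : m (a - b) -> m b -> m a.
Proof. by move=> ab mb; rewrite -(subrK b a); apply: mD. Qed.

(** Row [j] of the equation [A P = Q A], for [j] even and then for [j] odd; [p]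
and [q] are the rows of [P] and [Q], and [t] is the contribution to [A P] of row
[j - 1] of [P], assumed to vanish modulo [m^2] from column [j] on.  Both lemmas
compare the coefficients of [y], [z], [x] and [w] in each column. *)
Lemma ladder_row_even (n j : nat) (t p q : nat -> R) :
  ~~ odd j ->
  (forall i, (j <= i < n)%N -> ideal_pow m 2 (t i)) ->
  (forall i, (i < n)%N ->
    t i + w * p i = ladder_diag i * q i + ladder_side i * q i.+1) ->
  ((j < n)%N -> m (p j - q j)) /\ forall i, (j < i < n)%N -> m (p i).
Proof.
move=> oj t2 E; have [xw my mz _ nx nw multx multw indy indx indw] := L.
have ev i : (j <= i < n)%N -> ~~ odd i -> m (q i.+1) /\ m (p i - q i).
  move=> ji /negbTE oi; have [_ /E] := andP ji.
  rewrite /ladder_diag /ladder_side oi => Ei.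
  have m2t := t2 i ji; have [b tb] := multw _ m2t.
  have mq : m (q i.+1).
    apply: (indy _ (p i - q i + b) 0); apply: (eq_from (esym Ei)).
    by rewrite tb; ring.
  split=> //; apply: nw.
  have -> : (p i - q i) * w = y * q i.+1 - t i by apply: (eq_from Ei); ring.
  by apply: (msqrB R_local) => //; apply: msqrM.
have od i : (j < i < n)%N -> odd i -> m (q i) /\ m (q i.+1) /\ m (p i).
  move=> /andP[ji lti] oi.
  have mq : m (q i).
    case: i ji lti oi => // i ji lti oi.
    by have [|//] := ev i _ oi; rewrite -ltnS ji (ltnW lti).
  split=> //; have := E i lti; rewrite /ladder_diag /ladder_side oi => Ei.
  have m2t : ideal_pow m 2 (t i) by apply: t2; rewrite (ltnW ji).
  have m2xq := msqrM (pair_max1 xw) mq.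
  have [b tb] := multw _ (msqrB R_local m2t m2xq).
  have mq' : m (q i.+1).
    apply: (indw _ (p i + b)); rewrite mulrDl -tb; apply: (eq_from (esym Ei)).
    by ring.
  split=> //; apply: nw.
  have -> : p i * w = z * q i.+1 - (t i - x * q i) by apply: (eq_from Ei); ring.
  by apply: (msqrB R_local); [apply: msqrM|apply: (msqrB R_local)].
split=> [ltj|i /andP[ji lti]]; first by have [|//] := ev j _ oj; rewrite leqnn.
have [oi|oi] := boolP (odd i); first by have [|_ []//] := od i _ oi; rewrite ji.
have [|_] := ev i _ oi; first by rewrite (ltnW ji).
move=> /max_transfer; apply.
case: i ji lti oi => // i; rewrite ltnS leq_eqVlt => /orP[/eqP<-|ji] lti oi.
  by rewrite /= oj in oi.
by have [||_ []//] := od i; [rewrite ji (ltnW lti)|apply: negbNE].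
Qed.

Lemma ladder_row_odd (n j : nat) (t p q : nat -> R) :
  odd j ->
  (forall i, (j <= i < n)%N -> ideal_pow m 2 (t i)) ->
  (forall i, (i < n)%N ->
    t i + x * p i = ladder_diag i * q i + ladder_side i * q i.+1) ->
  ((j < n)%N -> m (p j - q j)) /\ forall i, (j < i < n)%N -> m (p i).
Proof.
move=> oj t2 E; have [xw my mz _ nx nw multx multw indy indx indw] := L.
have q_max i : (j <= i < n)%N -> m (q i.+1).
  move=> ji; have [_ /E] := andP ji; have m2t := t2 i ji.
  rewrite /ladder_diag /ladder_side; case: ifP => oi Ei.
    have [b tb] := multx _ m2t; apply: (indx _ (p i - q i + b)).
    by apply: (eq_from (esym Ei)); rewrite tb; ring.
  have [b tb] := multx _ m2t; apply: (indy _ (- q i) (p i + b)).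
  by apply: (eq_from (esym Ei)); rewrite tb; ring.
have od i : (j <= i < n)%N -> odd i -> m (p i - q i).
  move=> ji oi; have [_ /E] := andP ji.
  rewrite /ladder_diag /ladder_side oi => Ei; apply: nx.
  have -> : (p i - q i) * x = z * q i.+1 - t i by apply: (eq_from Ei); ring.
  apply: (msqrB R_local); last exact: t2.
  by apply: msqrM => //; apply: q_max.
split=> [ltj|i /andP[ji lti]]; first by apply: od; rewrite ?leqnn.
have mq : m (q i).
  by case: i ji lti => // i ji lti; apply: q_max; rewrite -ltnS ji (ltnW lti).
have ji' : (j <= i < n)%N by rewrite (ltnW ji).
have [oi|/negbTE oi] := boolP (odd i).
  by apply: max_transfer mq; apply: od.
have := E i lti; rewrite /ladder_diag /ladder_side oi => Ei; apply: nx.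
have -> : p i * x = w * q i + y * q i.+1 - t i by apply: (eq_from Ei); ring.
apply: (msqrB R_local); last exact: t2.
apply: (msqrD R_local); apply: msqrM => //; first exact: pair_max2 xw.
exact: q_max.
Qed.

(** The hypothesis is the equation [A P = Q A] written entrywise.  Modulo [m],
[P] is lower triangular with constant diagonal.  The proof goes by induction on
the row: a row of [P] satisfies the two lemmas above once the previous row is
known. *)
Lemma ladder_rigid (n : nat) (P Q : nat -> nat -> R) :
  (forall j i, (j < n)%N -> (i < n)%N ->
    (if j is j'.+1 then ladder_side j' * P j' i else 0) +
      ladder_diag j * P j i =
    ladder_diag i * Q j i + ladder_side i * Q j i.+1) ->
  forall j, (j < n)%N ->
    m (P j j - P 0%N 0%N) /\ forall i, (j < i < n)%N -> m (P j i).
Proof.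
move=> E; have [xw my mz _ nx nw multx multw indy indx indw] := L.
have mx := pair_max1 xw; have mw := pair_max2 xw.
have mS a b c : m (a - b) -> m (b - c) -> m (a - c).
  move=> ab bc; have -> : a - c = (a - b) + (b - c) by ring.
  exact: mD.
elim=> [|j IHj] jn.
  split=> [|i]; first by rewrite subrr; apply: (max0 R_local).
  have [||_] := @ladder_row_even n 0 (fun=> 0) (P 0%N) (Q 0%N) isT.
  - by move=> *; apply: (msqr0 R_local).
  - by move=> k ltk; exact: (E 0%N k jn ltk).
  - exact.
have [mjj mj] := IHj (ltnW jn).
pose t i := ladder_side j * P j i.
have ms k : m (ladder_side k) by rewrite /ladder_side; case: ifP.
have t2 i : (j.+1 <= i < n)%N -> ideal_pow m 2 (t i).
  by move=> ji; apply: msqrM => //; apply: mj.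
have Ej i (lti : (i < n)%N) := E j.+1 i jn lti.
have [oj|oj] := boolP (odd j.+1).
  have dj : ladder_diag j.+1 = x by rewrite /ladder_diag oj.
  have [|mpq mp] := @ladder_row_odd n j.+1 t (P j.+1) (Q j.+1) oj t2.
    by move=> i lti; rewrite -dj; apply: Ej.
  split=> //; apply: (mS _ _ _ (mpq jn)).
  have /negbTE oj' : ~~ odd j by move: oj.
  apply: (mS _ _ _ _ mjj).
  apply: (indy _ (- Q j.+1 j) (P j.+1 j)).
  have := Ej j (ltnW jn); rewrite dj /ladder_diag /ladder_side oj' => Ejj.
  by apply: (eq_from (esym Ejj)); ring.
have dj : ladder_diag j.+1 = w by rewrite /ladder_diag (negbTE oj).
have [|mpq mp] := @ladder_row_even n j.+1 t (P j.+1) (Q j.+1) oj t2.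
  by move=> i lti; rewrite -dj; apply: Ej.
split=> //; apply: (mS _ _ _ (mpq jn)); apply: (mS _ _ _ _ mjj).
have oj' : odd j by apply: negbNE.
have := Ej j (ltnW jn); rewrite dj /ladder_diag /ladder_side oj' => Ejj.
apply: contrapT => /(notin_max_unit R_local m3_eq0).
set u := _ - _ => uu.
(* If the diagonal entries [Q (j + 1) (j + 1)] and [P j j] were not congruent
   modulo [m], row [j + 1] would give, in column [j], [z] as a combination of
   [w] and [x].  The coefficient of [y] in column [j - 1] of that row then puts
   the coefficient of [x] in [m], so that [z] would be a multiple of [w]. *)
have zE : z = u^-1 * P j.+1 j * w - u^-1 * Q j.+1 j * x.
  rewrite -{1}(mulKr uu z) -!mulrA -mulrBr; congr (_ * _).
  by apply: (eq_from (esym Ejj)); rewrite /u; ring.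
case: j oj' => // i oi in IHj jn mjj mj t ms t2 Ej oj dj mpq mp Ejj u uu zE *.
have /negbTE oi' : ~~ odd i by move: oi.
have := Ej i (ltnW (ltnW jn)); rewrite dj /ladder_diag /ladder_side oi' oi => Eji.
have mQ : m (Q i.+2 i.+1).
  apply: (indy _ (u^-1 * P i.+2 i.+1 * P i.+1 i + P i.+2 i - Q i.+2 i)
                 (- (u^-1 * Q i.+2 i.+1 * P i.+1 i))).
  apply: (eq_from (esym Eji)).
  by rewrite {1}zE; ring.
have m2 : ideal_pow m 2 (u^-1 * Q i.+2 i.+1 * x).
  by apply: msqrM => //; apply: (maxMl R_local).
have [b e1] := multw _ m2.
apply: (max_not1 m3_eq0); apply: (indw _ (u^-1 * P i.+2 i.+1 - b)).
by rewrite mul1r zE e1 mulrBl.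
Qed.

End Rigidity.

(** * The kernel of a matrix as a module *)

Section KernelModule.

Variables (R : comUnitRingType) (n : nat) (A : 'M[R]_n).

(** The row vectors [v] with [v A = 0], and the submodule they form as a type. *)
Definition ker_pred : {pred 'rV[R]_n} := [pred v | v *m A == 0].

Lemma ker_pred_closed : submod_closed ker_pred.
Proof.
split=> [|a u v]; rewrite !inE ?mul0mx // => /eqP u0 /eqP v0.
by rewrite mulmxDl -scalemxAl u0 v0 scaler0 addr0.
Qed.

HB.instance Definition _ :=
  GRing.isSubmodClosed.Build R 'rV[R]_n ker_pred ker_pred_closed.

Record ker_mod := KerMod { ker_val : 'rV[R]_n; _ : ker_val \in ker_pred }.

HB.instance Definition _ := [isSub for ker_val].
HB.instance Definition _ := [Choice of ker_mod by <:].
HB.instance Definition _ := [SubChoice_isSubLmodule of ker_mod by <:].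

Lemma ker_valP (v : ker_mod) : ker_val v *m A = 0.
Proof. by apply/eqP; have := valP v; rewrite inE. Qed.

Lemma ker_valZ a (u : ker_mod) i : ker_val (a *: u) 0 i = a * ker_val u 0 i.
Proof. exact: (mxE _ (fun j k => a * ker_val u j k)). Qed.

Lemma ker_valB (u v : ker_mod) i :
  ker_val (u - v) 0 i = ker_val u 0 i - ker_val v 0 i.
Proof.
rewrite -[ker_val (u - v)]/(val (u - v)) raddfB /=.
by rewrite [LHS]mxE [X in _ + X]mxE.
Qed.

End KernelModule.

(** * Bidiagonal matrices *)

(** Exactness of [B] followed by [A] at the middle term, by descending induction
on the support of [v].  The matrices are triangular for the order on indices
given by [h]: a nonzero entry off the diagonal is at [(i, j)] with
[h j < h i].  This covers lower and upper triangular matrices. *)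
Lemma triangular_exact (R : comUnitRingType) (n : nat) (A B : 'M[R]_n)
    (h : 'I_n -> nat) :
  injective h ->
  (forall i j, i != j -> (h i <= h j)%N -> A i j = 0) ->
  (forall i j, i != j -> (h i <= h j)%N -> B i j = 0) ->
  (forall i a, a * A i i = 0 -> exists b, a = b * B i i) ->
  B *m A = 0 ->
  forall v : 'rV[R]_n, v *m A = 0 -> exists u, v = u *m B.
Proof.
move=> h_inj trA trB diagAB BA0 v.
have [k] : exists k, forall i, (k <= h i)%N -> v 0 i = 0.
  exists (\max_i h i).+1 => i; rewrite ltnNge => /negP[].
  exact: leq_bigmax.
elim: k v => [|k IHk] v v0 vA.
  exists 0; rewrite mul0mx; apply/rowP => i; rewrite mxE.
  exact: v0.
(* A multiple of row [i] of [B], where [h i] is maximal on the support, clears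
   the coefficient [v 0 i] because that coefficient is killed by [A i i]. *)
have [/existsP[i /eqP hi]|/existsPn nk] := boolP [exists i, h i == k]; last first.
  apply: IHk => // i; rewrite leq_eqVlt eq_sym (negbTE (nk i)).
  exact: v0.
have [c vi] : exists c, v 0 i = c * B i i.
  apply: diagAB; move/rowP/(_ i): vA; rewrite !mxE (bigD1 i) //= => <-.
  rewrite big1 ?addr0 // => l li.
  have [hil|hil] := leqP (h l) (h i); first by rewrite trA ?mulr0.
  by rewrite v0 ?mul0r // -hi.
have [||u vu] := IHk (v - c *: row i B).
- move=> l; rewrite !mxE leq_eqVlt => /orP[/eqP hl|hl].
    have -> : l = i by apply: h_inj; rewrite hi.
    by rewrite vi subrr.
  rewrite v0 // trB ?mulr0 ?subrr //; last by rewrite hi (ltnW hl).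
  by apply: contraTneq hl => <-; rewrite hi ltnn.
- by rewrite mulmxBl vA -scalemxAl -row_mul BA0 row0 scaler0 subrr.
exists (u + c *: delta_mx 0 i).
by rewrite mulmxDl -vu -scalemxAl -rowE subrK.
Qed.

Section Ladder.

Variable R : comUnitRingType.
Implicit Types d s : nat -> R.

(** The lower bidiagonal matrix with diagonal [d] and subdiagonal [s]; the entry
of the subdiagonal in column [i] is [s i].  Entries are given for all natural
numbers, so that the neighbours of an index need no bound. *)
Definition ladder_entry d s (j i : nat) : R :=
  if i == j then d j else if i.+1 == j then s i else 0.

Definition ladder_mx n d s : 'M[R]_n := \matrix_(j, i) ladder_entry d s j i.

Lemma ladder_entry_diag d s j : ladder_entry d s j j = d j.
Proof. by rewrite /ladder_entry eqxx. Qed.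

Lemma ladder_entry_sub d s j : ladder_entry d s j.+1 j = s j.
Proof. by rewrite /ladder_entry eqxx ltn_eqF. Qed.

Lemma ladder_entry_eq0 d s j i : i != j -> i.+1 != j -> ladder_entry d s j i = 0.
Proof. by rewrite /ladder_entry => /negbTE-> /negbTE->. Qed.

Lemma ladder_row_sum n d s (F : nat -> R) j : (j < n)%N ->
  \sum_(l < n) ladder_entry d s j l * F l =
  (if j is j'.+1 then s j' * F j' else 0) + d j * F j.
Proof.
move=> jn; rewrite (bigD1 (Ordinal jn)) //= ladder_entry_diag addrC.
congr (_ + _); case: j jn => [|j] jn.
  rewrite big1 // => l; rewrite -val_eqE /= => l0.
  by rewrite ladder_entry_eq0 // mul0r.
rewrite (bigD1 (Ordinal (ltnW jn))) /=; last by rewrite -val_eqE /= ltn_eqF.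
rewrite ladder_entry_sub big1 ?addr0 // => l /andP[].
rewrite -!val_eqE /= => lj1 lj.
by rewrite ladder_entry_eq0 // mul0r.
Qed.

Lemma ladder_col_sum n d s (F : nat -> R) i : (i < n)%N ->
  \sum_(l < n) F l * ladder_entry d s l i =
  d i * F i + (if (i.+1 < n)%N then s i * F i.+1 else 0).
Proof.
move=> lti; rewrite (bigD1 (Ordinal lti)) //= ladder_entry_diag mulrC.
congr (_ + _); case: ifP => i1n.
  rewrite (bigD1 (Ordinal i1n)) /=; last by rewrite -val_eqE /= gtn_eqF.
  rewrite ladder_entry_sub big1 ?addr0 1?mulrC // => l /andP[].
  rewrite -!val_eqE /= => li li1.
  by rewrite ladder_entry_eq0 ?mulr0 1?eq_sym.
rewrite big1 // => l; rewrite -val_eqE /= => li.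
rewrite ladder_entry_eq0 ?mulr0 1?eq_sym //.
by apply: contraFneq i1n => <-.
Qed.

Lemma ladder_mx_mul0 n d s d' s' :
  (forall k, d k * d' k = 0) ->
  (forall k, s k * d' k + d k.+1 * s' k = 0) ->
  (forall k, s k.+1 * s' k = 0) ->
  ladder_mx n d s *m ladder_mx n d' s' = 0.
Proof.
move=> dd sd ss; apply/matrixP => j i; rewrite !mxE.
under eq_bigr => l _ do rewrite !mxE.
rewrite (ladder_row_sum _ _ (fun l => ladder_entry d' s' l i)) //.
case: (val j) => [|k]; rewrite /ladder_entry.
  by rewrite add0r; case: eqP => _ /=; rewrite ?dd ?mulr0.
have [->|ik1] := eqVneq (val i) k.+1.
  by rewrite !gtn_eqF // mulr0 add0r dd.
rewrite eqSS; have [->|ik] := eqVneq (val i) k; first exact: sd.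
rewrite mulr0 addr0; have [<-|_] := eqVneq (val i).+1 k; last exact: mulr0.
exact: ss.
Qed.

Lemma ladder_exact n d s d' s' :
  (forall k a, a * d k = 0 -> exists b, a = b * d' k) ->
  ladder_mx n d' s' *m ladder_mx n d s = 0 ->
  forall v : 'rV[R]_n,
    v *m ladder_mx n d s = 0 -> exists u, v = u *m ladder_mx n d' s'.
Proof.
move=> dd BA; apply: (@triangular_exact _ _ _ _ (fun i : 'I_n => val i)) => //.
- exact: val_inj.
- move=> i j ij lij; rewrite mxE ladder_entry_eq0 //.
    by rewrite eq_sym.
  by rewrite gtn_eqF.
- move=> i j ij lij; rewrite mxE ladder_entry_eq0 //.
    by rewrite eq_sym.
  by rewrite gtn_eqF.
- by move=> i a; rewrite !mxE !ladder_entry_diag; apply: dd.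
Qed.

Lemma ladder_tr_exact n d s d' s' :
  (forall k a, a * d k = 0 -> exists b, a = b * d' k) ->
  ladder_mx n d s *m ladder_mx n d' s' = 0 ->
  forall v : 'rV[R]_n,
    v *m (ladder_mx n d s)^T = 0 -> exists u, v = u *m (ladder_mx n d' s')^T.
Proof.
move=> dd AB.
apply: (@triangular_exact _ _ _ _ (fun i : 'I_n => n - val i)%N).
- move=> i j; have := ltn_ord i; have := ltn_ord j => /ltnW lj /ltnW li eij.
  by apply: val_inj; rewrite /= -(subKn li) eij subKn.
- move=> i j ij; rewrite leq_sub2lE ?(ltnW (ltn_ord _)) // => lij.
  by rewrite !mxE ladder_entry_eq0 // gtn_eqF.
- move=> i j ij; rewrite leq_sub2lE ?(ltnW (ltn_ord _)) // => lij.
  by rewrite !mxE ladder_entry_eq0 // gtn_eqF.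
- by move=> i a; rewrite !mxE !ladder_entry_diag; apply: dd.
- by rewrite -trmx_mul AB trmx0.
Qed.

End Ladder.

(** * The modules, their total reflexivity and their resolutions *)

Section LadderModule.

Variables (R : comUnitRingType) (m : set R) (x w y z : R).
Hypotheses (R_local : local_ring m) (m3_eq0 : ideal_pow m 3 = [set 0]).
Hypothesis L : ladder_data m x w y z.
Variable n : nat.

(** The presentation matrix [A], and the matrix [B] that presents its syzygy. *)
Definition ladderA : 'M[R]_n := ladder_mx n (ladder_diag x w) (ladder_side y z).
Definition ladderB : 'M[R]_n :=
  ladder_mx n (ladder_diag w x) (fun k => - ladder_side y z k).

Lemma ladder_side_mul0 k : ladder_side y z k.+1 * ladder_side y z k = 0.
Proof.
rewrite /ladder_side /=; case: (odd k) => /=; first exact: (ladder_mul0 L).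
by rewrite mulrC; apply: (ladder_mul0 L).
Qed.

Lemma ladder_diag_mul0 k : ladder_diag x w k * ladder_diag w x k = 0.
Proof.
have wx := pair_mul0 (ladder_pair L).
by rewrite /ladder_diag; case: (odd k); rewrite // mulrC.
Qed.

Lemma ladder_diagS k : ladder_diag x w k.+1 = ladder_diag w x k.
Proof. by rewrite /ladder_diag /=; case: (odd k). Qed.

Lemma ladder_diagS' k : ladder_diag w x k.+1 = ladder_diag x w k.
Proof. by rewrite /ladder_diag /=; case: (odd k). Qed.

Lemma ladderAB : ladderA *m ladderB = 0.
Proof.
apply: ladder_mx_mul0 => k; first exact: ladder_diag_mul0.
  by rewrite ladder_diagS mulrN mulrC subrr.
by rewrite mulrN ladder_side_mul0 oppr0.
Qed.

Lemma ladderBA : ladderB *m ladderA = 0.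
Proof.
apply: ladder_mx_mul0 => k; first by rewrite mulrC; apply: ladder_diag_mul0.
  by rewrite ladder_diagS' mulNr mulrC addNr.
by rewrite mulNr ladder_side_mul0 oppr0.
Qed.

Lemma ladder_diag_ann k a :
  a * ladder_diag x w k = 0 -> exists b, a = b * ladder_diag w x k.
Proof.
have xw := ladder_pair L; rewrite /ladder_diag.
by case: (odd k); [apply: (pair_ann1 xw)|apply: (pair_ann2 xw)].
Qed.

Lemma ladder_diag_ann' k a :
  a * ladder_diag w x k = 0 -> exists b, a = b * ladder_diag x w k.
Proof.
have xw := ladder_pair L; rewrite /ladder_diag.
by case: (odd k); [apply: (pair_ann2 xw)|apply: (pair_ann1 xw)].
Qed.

Lemma ladderA_exact (v : 'rV[R]_n) :
  v *m ladderA = 0 <-> exists u, v = u *m ladderB.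
Proof.
split=> [|[u ->]]; last by rewrite -mulmxA ladderBA mulmx0.
by apply: ladder_exact; [exact: ladder_diag_ann|exact: ladderBA].
Qed.

Lemma ladderB_exact (v : 'rV[R]_n) :
  v *m ladderB = 0 <-> exists u, v = u *m ladderA.
Proof.
split=> [|[u ->]]; last by rewrite -mulmxA ladderAB mulmx0.
by apply: ladder_exact; [exact: ladder_diag_ann'|exact: ladderAB].
Qed.

Lemma ladderA_tr_exact (v : 'rV[R]_n) :
  v *m ladderA^T = 0 -> exists u, v = u *m ladderB^T.
Proof. by apply: ladder_tr_exact; [exact: ladder_diag_ann|exact: ladderAB]. Qed.

Lemma ladderB_tr_exact (v : 'rV[R]_n) :
  v *m ladderB^T = 0 -> exists u, v = u *m ladderA^T.
Proof. by apply: ladder_tr_exact; [exact: ladder_diag_ann'|exact: ladderBA]. Qed.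

Lemma ladderA_max j i : m (ladderA j i).
Proof.
have xw := ladder_pair L; have mx := pair_max1 xw; have mw := pair_max2 xw.
have my := ladder_max1 L; have mz := ladder_max2 L.
rewrite mxE /ladder_entry /ladder_diag /ladder_side.
by do !case: ifP => _ //; apply: (max0 R_local).
Qed.

Lemma ladderB_max j i : m (ladderB j i).
Proof.
have xw := ladder_pair L; have mx := pair_max1 xw; have mw := pair_max2 xw.
have my := ladder_max1 L; have mz := ladder_max2 L.
rewrite mxE /ladder_entry /ladder_diag /ladder_side.
by do !case: ifP => _ //; [apply: (maxN R_local)..|apply: (max0 R_local)].
Qed.

(** The kernel of [A], isomorphic to its cokernel: [ladder_proj], that is
multiplication by [B], is surjective onto it, with kernel the image of [A]. *)
Definition ladder_mod : lmodType R := ker_mod ladderA.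

Lemma ladder_proj_subproof (u : 'rV[R]_n) : u *m ladderB \in ker_pred ladderA.
Proof. by rewrite inE -mulmxA ladderBA mulmx0. Qed.

Definition ladder_proj (u : 'rV[R]_n) : ladder_mod :=
  KerMod (ladder_proj_subproof u).

Lemma ladder_proj_linear : linear ladder_proj.
Proof.
by move=> a u v; apply: val_inj; rewrite /= mulmxDl -scalemxAl.
Qed.

HB.instance Definition _ :=
  GRing.isLinear.Build R 'rV[R]_n ladder_mod *:%R ladder_proj ladder_proj_linear.

Lemma ladder_proj_surj : surjective ladder_proj.
Proof.
move=> v; have /ladderA_exact[u vu] := ker_valP v.
by exists u; apply: val_inj.
Qed.

Lemma ladder_proj_eq0 u : ladder_proj u = 0 <-> exists a, u = a *m ladderA.
Proof.
split=> [/(congr1 val) /= u0|]; first by apply/ladderB_exact.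
by move=> /ladderB_exact u0; apply: val_inj.
Qed.

Lemma fin_free_row : fin_free 'rV[R]_n.
Proof. by exists n, (idfun : {linear 'rV[R]_n -> 'rV[R]_n}); exists id. Qed.

(** The differentials of the two-periodic complex, according to the parity of
the degree. *)
Definition ladder_diff (b : bool) : {linear 'rV[R]_n -> 'rV[R]_n} :=
  mulmxr (if b then ladderB else ladderA).

Lemma ladder_diff_exact b : exact_at (ladder_diff (~~ b)) (ladder_diff b).
Proof. by case: b => v /=; [exact: ladderB_exact|exact: ladderA_exact]. Qed.

Lemma linear_form_row (u : {linear 'rV[R]_n -> R^o}) :
  exists c : 'cV[R]_n, forall b, u b = (b *m c) 0 0.
Proof.
exists (\col_j u (delta_mx 0 j)) => b.
rewrite {1}(row_sum_delta b) linear_sum mxE; apply: eq_bigr => j _.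
by rewrite linearZ !mxE.
Qed.

Lemma ladder_diff_dual_exact b :
  dual_exact_at (ladder_diff (~~ b)) (ladder_diff b).
Proof.
move=> u; have [c uc] := linear_form_row u; split=> [u0|[v uv] a]; last first.
  rewrite uv; have -> : ladder_diff b (ladder_diff (~~ b) a) = 0.
    by apply/ladder_diff_exact; exists a.
  exact: linear0.
have [t ct] : exists t : 'rV[R]_n,
    c^T = t *m (if b then ladderB else ladderA)^T.
  have c0 : c^T *m (if ~~ b then ladderB else ladderA)^T = 0.
    rewrite -trmx_mul; apply/rowP => i; rewrite mxE [RHS]mxE.
    by have := u0 (delta_mx 0 i); rewrite uc /= -mulmxA -rowE mxE.
  by case: b c0 {u0} => /=; [exact: ladderA_tr_exact|exact: ladderB_tr_exact].
have [a u' v'|v vE] :=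
    @linear_ex R 'rV[R]_n R^o (fun r : 'rV[R]_n => (r *m t^T) 0 0).
  by rewrite mulmxDl -scalemxAl !mxE.
exists v => r; rewrite vE uc /= -mulmxA; congr ((_ *m _) _ _).
by rewrite -[c]trmxK ct trmx_mul trmxK.
Qed.

Lemma odd_abszS (i : int) : odd (absz (i + 1)) = ~~ odd (absz i).
Proof.
case: i => k; first by rewrite -PoszD addn1.
rewrite NegzE.
have -> : - k.+1%:Z + 1 = - k%:Z by rewrite -addn1 PoszD opprD addrNK.
by rewrite !abszN /= negbK.
Qed.

Lemma ladder_totally_reflexive : totally_reflexive ladder_mod.
Proof.
split.
  exists n, (fun j => ladder_proj (delta_mx 0 j)).
  apply/seteqP; split=> // v _; have [u ->] := ladder_proj_surj v.
  exists (fun j => u 0 j); rewrite {1}(row_sum_delta u) linear_sum.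
  by apply: eq_bigr => j _; rewrite linearZ.
exists (fun=> 'rV[R]_n), (fun i : int => ladder_diff (odd (absz i))); split.
- by move=> _; apply: fin_free_row.
- by move=> i; rewrite odd_abszS; apply: ladder_diff_exact.
- by move=> i; rewrite odd_abszS; apply: ladder_diff_dual_exact.
exists ladder_proj; split; first exact: ladder_proj_surj.
by move=> u; apply: ladder_proj_eq0.
Qed.

Lemma ladder_resolution :
  exists (F : nat -> lmodType R) (d : forall i, {linear F i.+1 -> F i})
         (p : {linear F 0%N -> ladder_mod}),
    minimal_free_resolution m d p /\
    exists q : nat, (0 < q <= 2)%N /\ periodic d q.
Proof.
exists (fun=> 'rV[R]_n), (fun i => ladder_diff (odd i)), ladder_proj; split.
  split.
  - by move=> _; apply: fin_free_row.
  - exact: ladder_proj_surj.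
  - by move=> u; apply: ladder_proj_eq0.
  - by move=> i; apply: ladder_diff_exact.
  move=> i v; set r := ladder_diff _ v.
  exists n, (fun j => r 0 j), (fun j => delta_mx 0 j); split=> // [j|].
    rewrite /r mxE; apply: (max_sum R_local) => l _; apply: (maxMl R_local).
    by case: ifP => _; [exact: ladderB_max|exact: ladderA_max].
  exact: row_sum_delta.
exists 2%N; split=> //.
exists (fun=> idfun); split=> [i|i v]; first by exists id.
by rewrite /= addn2 /= negbK.
Qed.

End LadderModule.

(** * Indecomposability *)

Section Indecomposable.

Variables (R : comUnitRingType) (m : set R) (x w y z : R).
Hypotheses (R_local : local_ring m) (m3_eq0 : ideal_pow m 3 = [set 0]).
Hypothesis L : ladder_data m x w y z.

Lemma max_prod (I : finType) (F : I -> R) i : m (F i) -> m (\prod_i F i).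
Proof. by move=> mi; rewrite (bigD1 i) //=; apply: (maxMr R_local). Qed.

(** In the Leibniz formula, every permutation other than the identity picks an
entry above the diagonal. *)
Lemma triangular_mod_unitmx n (P : 'M[R]_n) :
  (forall j i : 'I_n, (j < i)%N -> m (P j i)) -> (forall j, ~ m (P j j)) ->
  P \in unitmx.
Proof.
move=> trP diagP; rewrite unitmxE; apply: (notin_max_unit R_local m3_eq0).
have upr : \prod_i P i i \is a GRing.unit.
  by apply/unitr_prodP => i *; apply: (notin_max_unit R_local m3_eq0).
suff md : m (\det P - \prod_i P i i).
  move=> mP; apply: (negP (max_nonunit R_local m3_eq0 _) upr).
  have -> : \prod_i P i i = \det P - (\det P - \prod_i P i i) by ring.
  exact: (maxB R_local).
rewrite /determinant (bigD1 (1%g : {perm 'I_n})) //= odd_perm1 expr0 mul1r.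
under eq_bigr => i _ do rewrite perm1.
rewrite addrAC subrr add0r; apply: (max_sum R_local) => s s1.
apply: (maxMl R_local).
have [i lti] : exists i : 'I_n, (i < s i)%N.
  apply/existsP; apply: contraR s1 => /existsPn le_s; apply/eqP/permP => i.
  rewrite perm1; have [k] := ubnP (val i).
  elim: k i => // k IHk i; rewrite ltnS => ik.
  have := le_s i; rewrite -leqNgt leq_eqVlt => /orP[/eqP/val_inj//|si].
  have := IHk (s i) (leq_trans si ik).
  by move/perm_inj => e1; rewrite e1 ltnn in si.
by apply: (@max_prod _ _ i); apply: trP.
Qed.

(** An invertible matrix sends generators to generators. *)
Lemma ladder_gen n (N : set (ladder_mod x w y z n)) (U : 'M[R]_n) :
  submodule N -> U \in unitmx -> (forall j, N (ladder_proj L (row j U))) ->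
  N = setT.
Proof.
move=> subN uU NU; apply/seteqP; split=> // v _.
have [u ->] := ladder_proj_surj L v.
rewrite -(mulmxKV uU u) mulmx_sum_row linear_sum /=.
apply: (submodule_sum subN) => j _.
by rewrite linearZ; apply: (submoduleZ subN); apply: NU.
Qed.

(** [P] and [1 - P] give the two components of the generators.  Both components
of a relation [row j A] are zero, since their sum is; so [A P = Q A]. *)
Lemma ladder_idempotent n (P1 Q1 : set (ladder_mod x w y z n.+1))
    (P : 'M[R]_n.+1) :
  submodule P1 -> submodule Q1 -> P1 `&` Q1 = [set 0] ->
  (forall j, P1 (ladder_proj L (row j P))) ->
  (forall j, Q1 (ladder_proj L (row j (1%:M - P)))) ->
  forall j : 'I_n.+1, m (P j j - P 0 0) /\
    forall i : 'I_n.+1, (j < i)%N -> m (P j i).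
Proof.
move=> subP subQ PQ0 PP QP.
have [Q QE] : exists Q : 'M[R]_n.+1, ladderA x w y z n.+1 *m P =
    Q *m ladderA x w y z n.+1.
  set A := ladderA _ _ _ _ _.
  have /choice[q qE] j : exists a, row j (A *m P) = a *m A.
    apply/(ladder_proj_eq0 L); rewrite row_mul.
    suff : (P1 `&` Q1) (ladder_proj L (row j A *m P)) by rewrite PQ0.
    split; rewrite ?[row j A *m P]mulmx_sum_row.
      rewrite linear_sum /=; apply: (submodule_sum subP) => i _.
      by rewrite linearZ; apply: (submoduleZ subP); apply: PP.
    rewrite -mulmx_sum_row.
    have -> : row j A *m P = row j A - row j A *m (1%:M - P).
      by rewrite mulmxBr mulmx1 subKr.
    rewrite linearB /=.
    have -> : ladder_proj L (row j A) = 0.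
      by apply/(ladder_proj_eq0 L); exists (delta_mx 0 j); rewrite rowE.
    rewrite sub0r; apply: (submoduleN subQ).
    rewrite mulmx_sum_row linear_sum /=; apply: (submodule_sum subQ) => i _.
    by rewrite linearZ; apply: (submoduleZ subQ); apply: QP.
  exists (\matrix_j q j); apply/row_matrixP => j.
  by rewrite qE row_mul rowK.
pose Pn (j i : nat) := P (inord j) (inord i).
pose Qn (j i : nat) := if (i < n.+1)%N then Q (inord j) (inord i) else 0.
have E j i : (j < n.+1)%N -> (i < n.+1)%N ->
    (if j is j'.+1 then ladder_side y z j' * Pn j' i else 0) +
      ladder_diag x w j * Pn j i =
    ladder_diag x w i * Qn j i + ladder_side y z i * Qn j i.+1.
  move=> jn lti; have := congr1 (fun C : 'M_n.+1 => C (inord j) (inord i)) QE.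
  rewrite !mxE.
  under eq_bigr => l _ do rewrite mxE inordK // -[P l _]/(P l (inord i))
    -[l in P l _]inord_val.
  rewrite (ladder_row_sum _ _ (fun l => Pn l i)) // => ->.
  under eq_bigr => l _ do rewrite mxE (inordK lti) -[l in Q _ l]inord_val.
  have := ladder_col_sum (ladder_diag x w) (ladder_side y z)
    (fun l => Q (inord j) (inord l)) lti.
  rewrite /Qn lti => ->; congr (_ + _).
  by case: ifP => _ //; rewrite mulr0.
move=> j; have [] := ladder_rigid R_local m3_eq0 L E (ltn_ord j).
rewrite /Pn !inord_val => mjj mj; split.
  have -> : (0 : 'I_n.+1) = inord 0 by apply: val_inj; rewrite /= inordK.
  exact: mjj.
by move=> i ji; have := mj i; rewrite inord_val ji ltn_ord; apply.
Qed.

Lemma ladder_indecomposable n : indecomposable (ladder_mod x w y z n.+1).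
Proof.
split.
  move=> z0; have /(ladder_proj_eq0 L)[a aE] := z0 (ladder_proj L (delta_mx 0 0)).
  apply: (max_not1 m3_eq0); have := congr1 (fun v : 'rV_n.+1 => v 0 0) aE.
  rewrite mxE !eqxx mulr1n mxE => ->; apply: (max_sum R_local) => i _.
  by apply: (maxMl R_local); apply: (ladderA_max R_local L).
move=> P1 Q1 subP subQ PQ0 PQT.
have /choice[u uE] j : exists u : 'rV[R]_n.+1,
    P1 (ladder_proj L u) /\ Q1 (ladder_proj L (delta_mx 0 j - u)).
  have [p [q [Pp Qq pq]]] := PQT (ladder_proj L (delta_mx 0 j)).
  have [u pu] := ladder_proj_surj L p; exists u.
  by rewrite -pu linearB /= pq -pu addrC addKr.
pose P : 'M[R]_n.+1 := \matrix_j u j.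
have PP j : P1 (ladder_proj L (row j P)) by rewrite rowK; have [] := uE j.
have QP j : Q1 (ladder_proj L (row j (1%:M - P))).
  by rewrite linearB /= rowK rowE mulmx1; have [] := uE j.
have tr := ladder_idempotent subP subQ PQ0 PP QP.
have [m0|nm0] := pselect (m (P 0 0)).
  left; have QT : Q1 = setT.
    apply: (ladder_gen subQ _ QP); apply: triangular_mod_unitmx => [j i ji|j].
      rewrite !mxE -val_eqE /= ltn_eqF // sub0r; apply: (maxN R_local).
      by have [_ /(_ i ji)] := tr j; rewrite mxE.
    move=> m1; apply: (max_not1 m3_eq0).
    have [mjj _] := tr j; rewrite !mxE eqxx /= in m1.
    have -> : 1 = (1 - u j 0 j) + (P j j - P 0 0) + P 0 0 by rewrite !mxE; ring.
    by do 2![apply: (maxD R_local) => //].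
  by rewrite -PQ0 QT setIT.
right; have PT : P1 = setT.
  apply: (ladder_gen subP _ PP); apply: triangular_mod_unitmx => [j i ji|j mj].
    by have [_ /(_ i ji)] := tr j.
  apply: nm0; have [mjj _] := tr j.
  have -> : P 0 0 = P j j - (P j j - P 0 0) by ring.
  exact: (maxB R_local).
by rewrite -PQ0 PT setTI.
Qed.

End Indecomposable.

(** * Length *)

(** If [N'] is generated by [g] over [N] and [m g] is contained in [N], then
[N' / N] is simple. *)
Lemma simple_step (R : comUnitRingType) (m : set R) (M : lmodType R)
    (N N' : set M) (g : M) :
  local_ring m -> ideal_pow m 3 = [set 0] -> submodule N -> N `<=` N' ->
  N' g -> ~ N g -> (forall a, m a -> N (a *: g)) ->
  (forall u, N' u -> exists a, N (u - a *: g)) ->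
  N `<` N' /\ forall P : set M, submodule P -> N `<=` P -> P `<=` N' ->
    P = N \/ P = N'.
Proof.
move=> Rl m3 subN NN' N'g nNg mN N'N.
split; first by split=> // /(_ g N'g).
move=> P subP NP PN'.
have [PN|/existsNP[v /not_implyP[Pv nNv]]] := pselect (forall v, P v -> N v).
  by left; apply/seteqP.
right; apply/seteqP; split=> // u /N'N[b Nub].
have [a Nva] := N'N v (PN' v Pv).
have ua : a \is a GRing.unit.
  apply: (notin_max_unit Rl m3) => ma; apply: nNv.
  by rewrite -(subrK (a *: g) v); apply: (submoduleD subN) => //; apply: mN.
have Pg : P g.
  rewrite -(scale1r g) -(mulVr ua) -scalerA; apply: (submoduleZ subP).
  rewrite -(subKr v (a *: g)); apply: (submoduleB subP) => //.
  exact: NP.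
rewrite -(subrK (b *: g) u); apply: (submoduleD subP); first exact: NP.
exact: submoduleZ.
Qed.

Section Length.

Variables (R : comUnitRingType) (m : set R) (x w y z : R).
Hypotheses (R_local : local_ring m) (m3_eq0 : ideal_pow m 3 = [set 0]).
Hypothesis L : ladder_data m x w y z.

Variables (e' n : nat) (b : nat -> 'I_e' -> R).
Hypothesis b_basis : forall k, basis_mod m (b k) (ladder_diag x w k).

(** A composition series of the ideal generated by the diagonal entry
[ladder_diag w x k] of [B], indexed by [0 <= r <= e' + 1].  Step [r <= e'] is
generated by the products of that entry with the first [r] elements of [b k].
The last step is all of [R] rather than the ideal itself: a last nonzero
coordinate lies in the ideal anyway ([ladder_last_coef]), while the preceding
coordinates must be left free. *)
Definition flag (k r : nat) : set R :=
  if (r <= e')%N then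
    [set v | exists c : 'I_e' -> R,
      v = (\sum_(i < e' | (i < r)%N) c i * b k i) * ladder_diag w x k]
  else setT.

(** The generator of step [r + 1] over step [r], divided by the diagonal entry;
it is [1] for the last step, [r = e']. *)
Definition flag_gen (k r : nat) : R :=
  if insub r is Some i then b k i else 1.

Lemma flag_ideal k r : @submodule R R^o (flag k r).
Proof.
apply/submoduleP; rewrite /flag; case: ifP => // _; split.
  by exists (fun=> 0); rewrite big1 ?mul0r // => i _; rewrite mul0r.
move=> a _ _ [c ->] [c' ->]; exists (fun i => a * c i + c' i).
rewrite /GRing.scale /= mulrA -mulrDl; congr (_ * _).
rewrite mulr_sumr -big_split; apply: eq_bigr => i _ /=; ring.
Qed.

Lemma flag0 k v : flag k 0 v -> v = 0.
Proof. by rewrite /flag /= => -[c ->]; rewrite big_pred0_eq mul0r. Qed.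

Lemma flag_full k r v : (e' < r)%N -> flag k r v.
Proof. by rewrite /flag ltnNge => /negbTE->. Qed.

Lemma flagS k r : flag k r `<=` flag k r.+1.
Proof.
move=> v; rewrite /flag; case: ifP => [re|/negbT]; last first.
  by rewrite -ltnNge => re; rewrite leqNgt ltnS (ltnW re).
move=> [c ->]; case: ifP => // re1.
exists (fun i : 'I_e' => if (i < r)%N then c i else 0); congr (_ * _).
rewrite big_mkcond [RHS]big_mkcond; apply: eq_bigr => i _ /=.
case: ifP => [ir|_]; first by rewrite ltnS (ltnW ir).
by rewrite mul0r if_same.
Qed.

Lemma flag_gen_in k r : (r <= e')%N ->
  flag k r.+1 (flag_gen k r * ladder_diag w x k).
Proof.
rewrite /flag /flag_gen leq_eqVlt => /orP[/eqP->|re]; first by rewrite ltnn.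
rewrite re insubT /=; exists (fun i : 'I_e' => (val i == r)%:R); congr (_ * _).
rewrite (bigD1 (Ordinal re)) //= eqxx mul1r big1 ?addr0 // => i /andP[_].
by rewrite -val_eqE /= => /negbTE->; rewrite mul0r.
Qed.

Lemma flag_gen_notin k r : (r <= e')%N ->
  ~ flag k r (flag_gen k r * ladder_diag w x k).
Proof.
have [mb _ b_free] := b_basis k; move=> re; rewrite /flag re => -[c cE].
have /(ladder_diag_ann' L)[a aE] :
    (\sum_(i < e' | (i < r)%N) c i * b k i - flag_gen k r) *
      ladder_diag w x k = 0.
  by rewrite mulrBl -cE subrr.
move: re aE; rewrite /flag_gen leq_eqVlt => /orP[/eqP er|re].
  rewrite insubN ?er ?ltnn // => aE.
  apply: (max_not1 m3_eq0).
  have xw := ladder_pair L.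
  have -> : 1 = \sum_(i < e' | (i < e')%N) c i * b k i - a * ladder_diag x w k.
    by rewrite -aE subKr.
  apply: (maxB R_local).
    by apply: (max_sum R_local) => i _; apply: (maxMl R_local).
  apply: (maxMl R_local); rewrite /ladder_diag.
  by case: ifP => _; [exact: (pair_max1 xw)|exact: (pair_max2 xw)].
rewrite insubT /= => aE; apply: (max_not1 m3_eq0).
have := b_free
  (fun i : 'I_e' => (if (i < r)%N then c i else 0) - (val i == r)%:R) a.
rewrite -aE => /(_ _ (Ordinal re)) /=; rewrite ltnn eqxx sub0r.
move=> H; rewrite -[1]opprK; apply: (maxN R_local); apply: H.
under eq_bigr => i _ do rewrite mulrBl.
rewrite sumrB; congr (_ - _).
  by rewrite [RHS]big_mkcond; apply: eq_bigr => i _; case: ifP; rewrite ?mul0r.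
rewrite (bigD1 (Ordinal re)) //= eqxx mul1r big1 ?addr0 // => i.
by rewrite -val_eqE /= => /negbTE->; rewrite mul0r.
Qed.

Lemma flag_gen_max k r a : (r <= e')%N -> m a ->
  flag k r (a * (flag_gen k r * ladder_diag w x k)).
Proof.
have [mb b_gen _] := b_basis k.
rewrite /flag /flag_gen => re ma; rewrite re; move: re.
have dd := ladder_diag_mul0 L k.
rewrite leq_eqVlt => /orP[/eqP->|re].
  rewrite insubN ?ltnn // mul1r; have [c [a' ->]] := b_gen a ma; exists c.
  rewrite mulrDl -mulrA dd mulr0 addr0; congr (_ * _).
  by apply: eq_bigl => i; rewrite ltn_ord.
rewrite insubT /=; exists (fun=> 0).
rewrite big1 ?mul0r => [|i _]; last by rewrite mul0r.
have m2 := msqrM ma (mb (Ordinal re)).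
suff [c ac] : exists c, a * b k (Ordinal re) = c * ladder_diag x w k.
  by rewrite mulrA ac -mulrA dd mulr0.
rewrite /ladder_diag; case: ifP => _; first exact: (ladder_mult1 L m2).
exact: (ladder_mult2 L m2).
Qed.

Lemma flag_gen_span k r v : (r <= e')%N -> flag k r.+1 v ->
  v * ladder_diag x w k = 0 ->
  exists a, flag k r (v - a * (flag_gen k r * ladder_diag w x k)).
Proof.
rewrite /flag /flag_gen => re; rewrite re; move: re.
rewrite leq_eqVlt => /orP[/eqP->|re].
  rewrite insubN ?ltnn // => _ /(ladder_diag_ann L)[a ->]; exists a.
  rewrite mul1r subrr; exists (fun=> 0).
  by rewrite big1 ?mul0r // => i _; rewrite mul0r.
rewrite insubT /= re => -[c ->] _; exists (c (Ordinal re)), c.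
rewrite mulrA -mulrBl; congr (_ * _).
rewrite (bigD1 (Ordinal re)) //= addrAC subrr add0r.
apply: eq_bigl => i; rewrite -val_eqE /= ltnS [(i <= r)%N]leq_eqVlt.
by have [->|_] := eqVneq; rewrite ?ltnn ?andbT.
Qed.

(** The composition series of the module.  With truncated subtraction, at
[t = k * (e' + 1) + r] the coordinates before [k] are free, the coordinate [k] is
in step [r] of its flag, and the following ones are zero. *)
Definition ladder_flag (t : nat) : set (ladder_mod x w y z n) :=
  [set v | forall i : 'I_n, flag i (t - i * e'.+1) (ker_val v 0 i)].

Lemma ladder_flag_submodule t : submodule (ladder_flag t).
Proof.
apply/submoduleP; split=> [i|a u v Nu Nv i].
  by rewrite mxE; apply: (submodule0 (flag_ideal _ _)).
have /submoduleP[_] := flag_ideal i (t - i * e'.+1).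
by move=> /(_ a _ _ (Nu i) (Nv i)); rewrite /= !mxE.
Qed.

Lemma ladder_flagP (k : 'I_n) r v : (r <= e'.+1)%N ->
  ladder_flag (k * e'.+1 + r) v <->
  (forall i : 'I_n, (k < i)%N -> ker_val v 0 i = 0) /\
  flag k r (ker_val v 0 k).
Proof.
move=> re; split=> [Nv|[v0 vk] i].
  split=> [i ki|]; last by have := Nv k; rewrite addKn.
  apply: (@flag0 i); have := Nv i.
  have /eqP-> : (k * e'.+1 + r - i * e'.+1 == 0)%N; last by [].
  rewrite subn_eq0 (leq_trans _ (leq_mul ki (leqnn _))) // mulSn addnC.
  by rewrite leq_add2r.
have [ik|ki|ik] := ltngtP i k; last first.
- have -> : i = k by apply: val_inj.
  by rewrite addKn.
- by rewrite v0 //; apply: (submodule0 (flag_ideal _ _)).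
apply: flag_full; rewrite -addnBAC ?leq_mul2r ?(ltnW ik) ?orbT //.
by rewrite -mulnBl ltn_addr // leq_pmull // subn_gt0.
Qed.

Lemma ladder_last_coef (k : 'I_n) (v : ladder_mod x w y z n) :
  (forall i : 'I_n, (k < i)%N -> ker_val v 0 i = 0) ->
  ker_val v 0 k * ladder_diag x w k = 0.
Proof.
move=> v0; have /rowP/(_ k) := ker_valP v; rewrite !mxE => <-.
rewrite (bigD1 k) //= !mxE ladder_entry_diag big1 ?addr0 // => l lk.
have [kl|lk'] := ltnP k l; first by rewrite v0 ?mul0r.
rewrite mxE ladder_entry_eq0 ?mulr0 //; last by rewrite gtn_eqF.
by rewrite eq_sym.
Qed.

Lemma ladder_length : has_length (ladder_mod x w y z n) (n * e'.+1).
Proof.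
exists ladder_flag; split.
- by move=> t _; apply: ladder_flag_submodule.
- apply/seteqP; split=> v; last first.
    by move=> ->; apply: (submodule0 (ladder_flag_submodule _)).
  move=> Nv; apply: val_inj; apply/rowP => i; rewrite [RHS]mxE.
  by apply: (@flag0 i); have := Nv i.
- apply/seteqP; split=> // v _ i; apply: flag_full.
  by rewrite -mulnBl leq_pmull // subn_gt0.
move=> t ltt; have kn : (t %/ e'.+1 < n)%N by rewrite ltn_divLR.
pose k := Ordinal kn; pose r := (t %% e'.+1)%N.
have tE : t = (k * e'.+1 + r)%N := divn_eq t e'.+1.
have re : (r <= e')%N by rewrite -ltnS ltn_mod.
have N0 v := @ladder_flagP k r v (leqW re).
have N1 v := @ladder_flagP k r.+1 v re.
rewrite tE -addnS.
pose g := ladder_proj L (flag_gen k r *: delta_mx 0 k : 'rV_n).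
have gE i : ker_val g 0 i = flag_gen k r * ladderB x w y z n k i.
  by rewrite /= -scalemxAl mxE -rowE mxE.
have g0 (i : 'I_n) : (k < i)%N -> ker_val g 0 i = 0.
  move=> ki; rewrite gE mxE ladder_entry_eq0 ?mulr0 // gtn_eqF //.
  exact: ltnW.
have gk : ker_val g 0 k = flag_gen k r * ladder_diag w x k.
  by rewrite gE mxE ladder_entry_diag.
apply: (simple_step R_local m3_eq0 (ladder_flag_submodule _) (g := g)).
- by move=> v /N0[v0 vk]; apply/N1; split=> //; apply: flagS.
- by apply/N1; split; rewrite ?gk //; apply: flag_gen_in.
- by move=> /N0[_]; rewrite gk; apply: flag_gen_notin.
- move=> a ma; apply/N0; split=> [i ki|]; rewrite ker_valZ.
    by rewrite g0 ?mulr0.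
  by rewrite gk; apply: flag_gen_max.
move=> v /N1[v0 vk].
have [a va] := flag_gen_span re vk (ladder_last_coef v0).
exists a; apply/N0; split=> [i ki|]; rewrite ker_valB ker_valZ.
  by rewrite v0 // g0 // mulr0 subrr.
by rewrite gk.
Qed.

End Length.

(** * The theorem *)

Theorem mainTheorem1 (R : comUnitRingType) (m : set R) (e : nat)
    (R_noeth : noetherian R) (R_local : local_ring m)
    (m3_eq0 : ideal_pow m 3 = [set 0])
    (R_not_gor : ~ gorenstein_local R)
    (m_dim : cotangent_dim m e)
    (R_ezd : exists x : R, exact_zero_divisor x) :
  exists M : nat -> lmodType R, forall n : nat, (0 < n)%N ->
    [/\ indecomposable (M n),
        totally_reflexive (M n),
        has_length (M n) (n * e) &
        exists (F : nat -> lmodType R) (d : forall i, {linear F i.+1 -> F i})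
               (p : {linear F 0%N -> M n}),
          minimal_free_resolution m d p /\
          exists q : nat, (0 < q <= 2)%N /\ periodic d q].
Proof.
have [x /(exact_zero_divisor_pair R_local m3_eq0)[w xw]] := R_ezd.
have wx := exact_pair_sym R_local m3_eq0 xw.
have [[y [z L]] nx nw] := ladder_data_exists R_local m3_eq0 R_not_gor m_dim xw.
have [e1 [bx [ee1 bx_basis]]] :=
  cotangent_basis_mod R_local m3_eq0 xw nx m_dim.
have [e2 [bw [ee2 bw_basis]]] :=
  cotangent_basis_mod R_local m3_eq0 wx nw m_dim.
have e12 : e2 = e1 by apply: succn_inj; rewrite -ee1 -ee2.
subst e2 e.
pose b k := if odd k then bx else bw.
have b_basis k : basis_mod m (b k) (ladder_diag x w k).
  by rewrite /b /ladder_diag; case: (odd k).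
exists (ladder_mod x w y z) => n n0; split.
- by case: n n0 => // n _; apply: (ladder_indecomposable R_local m3_eq0 L).
- exact: (ladder_totally_reflexive L).
- exact: (ladder_length R_local m3_eq0 L n b_basis).
- exact: (ladder_resolution R_local L).
Qed.
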